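(* There are universal constants $c,r_*>0$ such that the following holds. Let $k\geq1$, $n\geq1$ and $d_1,\ldots,d_k\geq2$ be integers, $D=\prod_{a=1}^k d_a$ and $d_{\max}=\max_a d_a$. (i) For every mode $a\in\{1,\ldots,k\}$ and every estimator $\widetilde\Theta_a$ (with values in $\mathrm{PD}(d_a)$) of the canonical factor in mode $a$, $$\sup_{\Theta_a\in\mathcal B_{d_a}^0(r_* )}\mathbb P_{\Theta_a}\left\{d_{\rm FR}(\widetilde\Theta_a,\Theta_a)\geq c\min\left(\sqrt{d_a},\frac{d_a^{3/2}}{\sqrt{nD}}\right)\right\}\geq\frac12,$$ $$\sup_{\Theta_a\in\mathcal B_{d_a}^0(r_* )}\mathbb P_{\Theta_a}\left\{d_{\rm op}(\widetilde\Theta_a,\Theta_a)\geq c\min\left(1,\frac{d_a}{\sqrt{nD}}\right)\right\}\geq\frac12 ,$$ where all factors other than the one in mode $a$ are fixed at the identity. (ii) For every $\mathrm{PD}(D)$-valued estimator $\widetilde\Theta$ of the full precision, $$\sup_{\Theta\in\mathcal P}\mathbb P_\Theta\left\{d_{\rm FR}(\widetilde\Theta,\Theta)\geq c\min\left(\sqrt D,\frac{d_{\max}}{\sqrt n}\right)\right\}\geq\frac12 .$$ Consequently, the corresponding minimax expected squared risks $$\inf_{\widetilde\Theta_a}\sup_{\Theta_a\in\mathcal B^0_{d_a}(r_* )}\mathbb E_{\Theta_a}d_{\rm FR}(\widetilde\Theta_a,\Theta_a)^2,\quad \inf_{\widetilde\Theta_a}\sup_{\Theta_a\in\mathcal B^0_{d_a}(r_*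 )}\mathbb E_{\Theta_a}d_{\rm op}(\widetilde\Theta_a,\Theta_a)^2,\quad \inf_{\widetilde\Theta}\sup_{\Theta\in\mathcal P}\mathbb E_{\Theta}d_{\rm FR}(\widetilde\Theta,\Theta)^2$$ are bounded below by universal positive constant multiples of $\min\{d_a,d_a^3/(nD)\}$, $\min\{1,d_a^2/(nD)\}$ and $\min\{D,d_{\max}^2/n\}$, respectively.
   Context: $\mathrm{PD}(d)$ is the cone of real symmetric positive-definite $d\times d$ matrices, and $\mathcal P=\{\Theta_1\otimes\cdots\otimes\Theta_k:\Theta_a\in\mathrm{PD}(d_a)\}\subset \mathrm{PD}(D)$. The canonical factors of an element of $\mathcal P$ are the unique representatives for which $(\det\Theta_a)^{1/d_a}$ is the same for every $a$. For positive-definite $A,B$ of the same dimension, $d_{\rm FR}(A,B)=\frac1{\sqrt2}\|\log(A^{-1/2}BA^{-1/2})\|_F$ (Frobenius norm) and $d_{\rm op}(A,B)=\|\log(A^{-1/2}BA^{-1/2})\|_{\rm op}$ (spectral norm). For $r_*>0$, $$\mathcal B_d^0(r_* )=\{A\in\mathrm{PD}(d):\det A=1,\ d_{\rm op}(A,I_d)\leq r_*\}.$$ For $\Theta\in\mathcal P$, $\mathbb P_\Theta$ (expectation $\mathbb E_\Theta$) is the law of $n$ independent observations $X_1,\ldots,X_n\sim N(0,\Theta^{-1})$ in $\mathbb R^{d_1}\otimes\cdots\otimes\mathbb R^{d_k}\cong\mathbb R^D$. For $\Theta_a\in\mathrm{PD}(d_a)$, $\mathbb P_{\Theta_a}$ (expectation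 $\mathbb E_{\Theta_a}$) is the law when the precision is $I_{d_1}\otimes\cdots\otimes\Theta_a\otimes\cdots\otimes I_{d_k}$, with $\Theta_a$ in position $a$. An estimator is a measurable function of $(X_1,\ldots,X_n)$. *)

(* Defs.v *)
From HB Require Import structures.
From mathcomp Require Import all_boot all_order all_algebra.
From mathcomp Require Import all_classical all_reals all_analysis.

Set Implicit Arguments.
Unset Strict Implicit.
Unset Printing Implicit Defensive.

Import Order.TTheory GRing.Theory Num.Theory.
Import numFieldNormedType.Exports.

Local Open Scope classical_set_scope.
Local Open Scope ring_scope.

Section matrix_geometry.
Context {R : realType}.

Definition posdef p : set 'M[R]_p :=
  [set A | A^T = A /\ forall v : 'cV[R]_p, v != 0 -> 0 < (v^T *m A *m v) 0 0].

(* Functional calculus: f applied to the eigenvalues of a symmetric matrix.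
   The result does not depend on the orthogonal diagonalization, so the set
   below is a singleton when A is symmetric; it is empty, and the junk value 0
   is returned, when A is not orthogonally diagonalizable. *)
Definition mxfun p (f : R -> R) (A : 'M[R]_p) : 'M[R]_p :=
  xget 0 [set B | exists (Q : 'M[R]_p) (l : 'rV[R]_p),
    [/\ Q *m Q^T = 1%:M,
        A = Q^T *m diag_mx l *m Q &
        B = Q^T *m diag_mx (map_mx f l) *m Q]].

Definition sqrtmx p (A : 'M[R]_p) : 'M[R]_p := mxfun Num.sqrt A.
Definition logmx p (A : 'M[R]_p) : 'M[R]_p := mxfun (@ln R) A.

Definition frobenius p q (A : 'M[R]_(p, q)) : R :=
  Num.sqrt (\sum_i \sum_j A i j ^+ 2).

(* On a column vector, frobenius is the Euclidean norm. *)
Definition opnorm p (A : 'M[R]_p) : R :=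
  sup [set frobenius (A *m v) | v in [set v : 'cV[R]_p | frobenius v <= 1]].

Definition rel_log p (A B : 'M[R]_p) : 'M[R]_p :=
  logmx (invmx (sqrtmx A) *m B *m invmx (sqrtmx A)).

Definition d_FR p (A B : 'M[R]_p) : R :=
  (Num.sqrt 2)^-1 * frobenius (rel_log A B).

Definition d_op p (A B : 'M[R]_p) : R := opnorm (rel_log A B).

Definition det1_ball p (r : R) : set 'M[R]_p :=
  [set A | [/\ posdef A, \det A = 1 & d_op A 1%:M <= r]].

End matrix_geometry.

Arguments d_FR {R p} A B.
Arguments d_op {R p} A B.

(* Rows and columns of a matrix on R^(d 0) (x) ... (x) R^(d (k-1)) are indexed
   by multi-indices, listed in the order of the library's enumeration. *)
Definition mindex k (d : 'I_k -> nat) : finType :=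
  {dffun forall a : 'I_k, 'I_(d a)}.

Lemma card_mindex k (d : 'I_k -> nat) : #|mindex d| = (\prod_a d a)%N.
Proof.
rewrite card_dep_ffun foldrE big_image /=.
by apply: eq_bigr => a _; rewrite card_ord.
Qed.

Section kronecker.
Context {R : realType} (k : nat) (d : 'I_k -> nat).

Definition kron (Theta : forall a, 'M[R]_(d a)) : 'M[R]_#|mindex d| :=
  \matrix_(i, j) \prod_a Theta a ((enum_val i : mindex d) a)
                                 ((enum_val j : mindex d) a).

Definition kron_class : set 'M[R]_#|mindex d| :=
  [set kron Theta | Theta in
     [set Theta : forall a, 'M[R]_(d a) | forall a, posdef (Theta a)]].

Definition mode_precision (a : 'I_k) (Theta_a : 'M[R]_(d a)) :
    'M[R]_#|mindex d| :=
  kron (dfwith (fun b => 1%:M : 'M[R]_(d b)) a Theta_a).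

End kronecker.

Arguments kron_class : clear implicits.

Section product_probability.
Context d1 d2 (T1 : measurableType d1) (T2 : measurableType d2) (R : realType).
Variables (P : probability T1 R) (Q : probability T2 R).

Definition prod_prob := (P \x Q)%E.

HB.instance Definition _ := Measure.on prod_prob.

Let prod_prob_setT : prod_prob setT = 1%E.
Proof.
rewrite /prod_prob -setXTT product_measure1E//.
by rewrite -[1%E]mule1; congr (_ * _)%E; exact: probability_setT.
Qed.

HB.instance Definition _ :=
  Measure_isProbability.Build _ _ _ prod_prob prod_prob_setT.

End product_probability.

Section iid.
Context dT (T : measurableType dT) (R : realType).

Definition tcons n (x : T * n.-tuple T) : n.+1.-tuple T :=
  [tuple of x.1 :: x.2].

Let measurable_tcons n : measurable_fun setT (@tcons n).
Proof. exact: measurable_cons. Qed.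

HB.instance Definition _ n :=
  isMeasurableFun.Build _ _ _ _ (@tcons n) (@measurable_tcons n).

Fixpoint iid (P : probability T R) (n : nat) : probability (n.-tuple T) R :=
  match n with
  | 0 => \d_([tuple] : 0.-tuple T)
  | m.+1 => distribution (prod_prob P (iid P m)) (@tcons m)
  end.

End iid.

Section gaussian.
Context {R : realType}.

(* normal_prob lives on measurableTypeR R, a copy of R with the same Borel sets
   but another display; toR transports it to R itself. *)
Definition toR : measurableTypeR R -> R := idfun.

HB.instance Definition _ :=
  isMeasurableFun.Build _ _ _ _ toR (@measurable_id _ _ setT).

Definition std_normal : probability R R := distribution (normal_prob 0 1) toR.

Definition mulmx_tuple p (S : 'M[R]_p) (z : p.-tuple R) : p.-tuple R :=
  [tuple \sum_j S i j * tnth z j | i < p].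

Let measurable_mulmx_tuple p (S : 'M[R]_p) :
  measurable_fun setT (mulmx_tuple S).
Proof.
apply/measurable_fun_tnthP => i.
rewrite [X in measurable_fun _ X](_ : _ =
  fun z : p.-tuple R => \sum_j S i j * tnth z j); last first.
  by apply/funext => z /=; rewrite tnth_mktuple.
by apply: measurable_sum => j; apply: measurable_realfun.measurable_funM => //;
  exact: measurable_tnth.
Qed.

HB.instance Definition _ p (S : 'M[R]_p) :=
  isMeasurableFun.Build _ _ _ _ (mulmx_tuple S) (@measurable_mulmx_tuple p S).

(* N(0, Sigma) is the law of Sigma^(1/2) Z with Z standard normal. *)
Definition mvnormal0 p (Sigma : 'M[R]_p) : probability (p.-tuple R) R :=
  distribution (iid std_normal p) (mulmx_tuple (sqrtmx Sigma)).

Definition sample_law n p (Theta : 'M[R]_p) :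
    probability (n.-tuple (p.-tuple R)) R :=
  iid (mvnormal0 (invmx Theta)) n.

End gaussian.

Arguments sample_law {R} n {p} Theta.

Section minimax.
Context {R : realType} dX (X : measurableType dX) (p : nat).

(* Entrywise measurability is Borel measurability for 'M[R]_p. *)
Definition estimator : set (X -> 'M[R]_p) :=
  [set delta : X -> 'M[R]_p |
    (forall i j, measurable_fun setT (fun x => delta x i j)) /\
    forall x, posdef (delta x)].

Variables (S : set 'M[R]_p) (P : 'M[R]_p -> probability X R).
Variable dist : 'M[R]_p -> 'M[R]_p -> R.

Definition sup_error_prob (delta : X -> 'M[R]_p) (r : R) : \bar R :=
  ereal_sup [set P Theta [set x | r <= dist (delta x) Theta] | Theta in S].

Definition minimax_sq_risk : \bar R :=
  ereal_inf
    [set ereal_sup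
      [set expectation (P Theta) (fun x => dist (delta x) Theta ^+ 2)
        | Theta in S]
      | delta in estimator].

End minimax.

(* Main.v *)
From HB Require Import structures.
Require Import Defs.
From mathcomp Require Import all_boot all_order all_algebra.
From mathcomp Require Import all_classical all_reals all_analysis.
From mathcomp Require Import measurable_realfun.
From mathcomp Require Import zify ring lra.

Set Implicit Arguments.
Unset Strict Implicit.
Unset Printing Implicit Defensive.

Import Order.TTheory GRing.Theory Num.Theory.
Import numFieldNormedType.Exports.

Local Open Scope classical_set_scope.
Local Open Scope ring_scope.

(* The affine-invariant distances are compared with a Euclidean one: along the geodesic
   from A to B the resolvent (1 + A)^-1 is Lipschitz for d_FR, because
   G (1 + G^T G)^-1 has operator norm at most 1/2; hence
   2 |(1 + A)^-1 - (1 + B)^-1|_F^2 <= d_FR(A, B)^2, and d_op follows from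
   2 d_FR^2 <= d d_op^2.

   The parameters are M^T M with M = [[1, e T], [0, 1]], so that the determinant is 1. Here
   T runs over matrices B with entries on a grid of 128 points, of size d^-1/2, replaced by
   T = B (1 + h^2 B^T B)^-1, which has operator norm at most 1 / (2 h) for every B, while
   |B - T|_F^2 <= (h^2 / 4) |B^T B|_F^2; the fourth moment E |B^T B|_F^2 is of order d, so by
   Markov T is close to B for at least three quarters of the grid. A count of Hamming balls
   then bounds the fraction of parameters in any ball of radius of order e sqrt d by
   32^-N, with N of order d^2.

   With precision Theta >= 3/4, the law N(0, Theta^-1) has a density L with respect to N(0, 1)
   with E L^2 <= exp |Theta - 1|_F^2, so the n-sample second moment is at most 2^N for e of
   order min(1, d / sqrt(n D)). As P(A) <= t Q(A) / 2 + E L^2 / (2 t), averaging over the grid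
   the probabilities that an estimator falls near the true parameter shows that they cannot
   all exceed 1/2. The bound for the full precision is the same argument in the largest mode,
   since Theta |-> 1 (x) Theta (x) 1 multiplies squared Frobenius norms by D / d. *)

(** * Matrix norms and the real spectral theorem *)

(** Entrywise rules for use where [mxE] would unfold matrix products as well. *)
Lemma mxDE (V : nmodType) m n (A B : 'M[V]_(m, n)) i j :
  (A + B) i j = A i j + B i j.
Proof. by rewrite mxE. Qed.

Lemma mxNE (V : zmodType) m n (A : 'M[V]_(m, n)) i j : (- A) i j = - A i j.
Proof. by rewrite mxE. Qed.

Lemma mxZE (R : pzRingType) m n a (A : 'M[R]_(m, n)) i j : (a *: A) i j = a * A i j.
Proof. by rewrite mxE. Qed.

Section fsq.
Context {R : realType}.
Implicit Types (m n p : nat).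

Definition fsq m n (A : 'M[R]_(m, n)) : R := \sum_i \sum_j A i j ^+ 2.

Lemma frobeniusE m n (A : 'M[R]_(m, n)) : frobenius A = Num.sqrt (fsq A).
Proof. by []. Qed.

Lemma fsq_ge0 m n (A : 'M[R]_(m, n)) : 0 <= fsq A.
Proof. by apply: sumr_ge0 => i _; apply: sumr_ge0 => j _; rewrite sqr_ge0. Qed.

Lemma fsq_tr m n (A : 'M[R]_(m, n)) : fsq A^T = fsq A.
Proof.
rewrite /fsq exchange_big; apply: eq_bigr => i _; apply: eq_bigr => j _.
by rewrite mxE.
Qed.

Lemma fsqE m n (A : 'M[R]_(m, n)) : fsq A = \tr (A^T *m A).
Proof.
rewrite /fsq exchange_big; apply: eq_bigr => i _; rewrite mxE.
by apply: eq_bigr => j _; rewrite mxE expr2.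
Qed.

Lemma fsq_cV n (v : 'cV[R]_n) : fsq v = (v^T *m v) 0 0.
Proof. by rewrite fsqE /mxtrace big_ord1. Qed.

Lemma fsq_eq0 m n (A : 'M[R]_(m, n)) : fsq A = 0 -> A = 0.
Proof.
move=> A0; apply/matrixP => i j; rewrite mxE; apply/eqP.
rewrite -sqrf_eq0 eq_le sqr_ge0 andbT -A0 /fsq (bigD1 i)//= (bigD1 j)//= -addrA lerDl.
rewrite addr_ge0//; first by apply: sumr_ge0 => k _; rewrite sqr_ge0.
by apply: sumr_ge0 => k _; apply: sumr_ge0 => l _; rewrite sqr_ge0.
Qed.

Lemma fsqZ m n a (A : 'M[R]_(m, n)) : fsq (a *: A) = a ^+ 2 * fsq A.
Proof.
rewrite /fsq mulr_sumr; apply: eq_bigr => i _; rewrite mulr_sumr.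
by apply: eq_bigr => j _; rewrite mxE exprMn.
Qed.

Lemma fsqN m n (A : 'M[R]_(m, n)) : fsq (- A) = fsq A.
Proof. by rewrite -scaleN1r fsqZ sqrrN expr1n mul1r. Qed.

Lemma fsqB m n (A B : 'M[R]_(m, n)) : fsq (A - B) = fsq (B - A).
Proof. by rewrite -fsqN opprB. Qed.

Lemma fsqD_le m n (A B : 'M[R]_(m, n)) : fsq (A + B) <= 2 * fsq A + 2 * fsq B.
Proof.
rewrite /fsq !mulr_sumr -big_split; apply: ler_sum => i _ /=.
rewrite !mulr_sumr -big_split; apply: ler_sum => j _ /=.
by rewrite mxE -subr_ge0 (_ : _ - _ = (A i j - B i j) ^+ 2) ?sqr_ge0//; ring.
Qed.

Lemma fsqD3_le m n (A B C : 'M[R]_(m, n)) :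
  fsq (A + B + C) <= 3 * fsq A + 3 * fsq B + 3 * fsq C.
Proof.
rewrite /fsq !mulr_sumr -!big_split; apply: ler_sum => i _ /=.
rewrite !mulr_sumr -!big_split; apply: ler_sum => j _ /=.
rewrite !mxE -subr_ge0.
rewrite (_ : _ - _ = (A i j - B i j) ^+ 2 + (A i j - C i j) ^+ 2 + (B i j - C i j) ^+ 2).
  by rewrite !addr_ge0// sqr_ge0.
ring.
Qed.

(** The double sum of [(a i - a j) ^+ 2] is nonnegative and equals twice the difference of the two
    sides. *)
Lemma sqr_sum_le N (a : 'I_N -> R) : (\sum_i a i) ^+ 2 <= N%:R * \sum_i a i ^+ 2.
Proof.
have : 0 <= \sum_i \sum_j (a i - a j) ^+ 2.
  by apply: sumr_ge0 => i _; apply: sumr_ge0 => j _; rewrite sqr_ge0.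
under eq_bigr do under eq_bigr do rewrite sqrrB.
under eq_bigr do rewrite big_split sumrB /= sumr_const card_ord sumrMnl -mulr_sumr.
rewrite big_split sumrB /= sumr_const card_ord sumrMnl sumrMnl -mulr_suml -expr2 => H.
rewrite -subr_ge0 -(pmulr_rge0 _ (ltr0n R 2)).
apply: le_trans H _; rewrite le_eqVlt; apply/orP; left; apply/eqP.
ring.
Qed.

Lemma fsq_sum_le m n N (A : 'I_N -> 'M[R]_(m, n)) :
  fsq (\sum_i A i) <= N%:R * \sum_i fsq (A i).
Proof.
rewrite /fsq [X in _ <= _ * X]exchange_big mulr_sumr; apply: ler_sum => i _.
rewrite [X in _ <= _ * X]exchange_big mulr_sumr; apply: ler_sum => j _.
by rewrite summxE; exact: sqr_sum_le.
Qed.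

Lemma fsq_col m n (A : 'M[R]_(m, n)) : fsq A = \sum_j fsq (col j A).
Proof.
rewrite /fsq exchange_big; apply: eq_bigr => j _; apply: eq_bigr => i _.
by rewrite big_ord1 mxE.
Qed.

Lemma fsq_orthl m n (Q : 'M[R]_m) (A : 'M[R]_(m, n)) : Q^T *m Q = 1%:M ->
  fsq (Q *m A) = fsq A.
Proof. by move=> QQ; rewrite !fsqE trmx_mul -mulmxA (mulmxA Q^T) QQ mul1mx. Qed.

Lemma fsq_orthr m n (Q : 'M[R]_n) (A : 'M[R]_(m, n)) : Q *m Q^T = 1%:M ->
  fsq (A *m Q) = fsq A.
Proof. by move=> QQ; rewrite -fsq_tr trmx_mul fsq_orthl ?trmxK ?fsq_tr. Qed.

Lemma fsq_diag n (l : 'rV[R]_n) : fsq (diag_mx l) = \sum_i l 0 i ^+ 2.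
Proof.
apply: eq_bigr => i _; rewrite (bigD1 i)//= mxE eqxx mulr1n big1 ?addr0// => j ji.
by rewrite mxE eq_sym (negbTE ji) mulr0n expr0n.
Qed.

(* [c] bounds the square of the operator norm of [A]. *)
Definition opb m n (A : 'M[R]_(m, n)) (c : R) :=
  forall v : 'cV[R]_n, fsq (A *m v) <= c * fsq v.

Lemma opb_mull m n p (A : 'M[R]_(m, n)) (B : 'M[R]_(n, p)) c :
  opb A c -> fsq (A *m B) <= c * fsq B.
Proof.
move=> Ac; rewrite fsq_col (fsq_col B) mulr_sumr; apply: ler_sum => j _.
by rewrite !colE -mulmxA; exact: Ac.
Qed.

Lemma opb_mulr m n p (A : 'M[R]_(m, n)) (B : 'M[R]_(n, p)) c :
  opb B^T c -> fsq (A *m B) <= c * fsq A.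
Proof. by move=> Bc; rewrite -fsq_tr trmx_mul -(fsq_tr A); exact: opb_mull. Qed.

Lemma dotC n (u v : 'cV[R]_n) : (u^T *m v) 0 0 = (v^T *m u) 0 0.
Proof. by rewrite -[u^T *m v]trmxK trmx_mul trmxK mxE. Qed.

Lemma fsqDE n (u v : 'cV[R]_n) : fsq (u + v) = fsq u + 2 * (u^T *m v) 0 0 + fsq v.
Proof.
rewrite !fsq_cV [(u + v)^T]linearD /= mulmxDl !mulmxDr mxE [(u^T *m u + _) 0 0]mxE.
by rewrite [(v^T *m u + _) 0 0]mxE (dotC v u); ring.
Qed.

Section resolvent.
Variables (m n : nat) (G : 'M[R]_(m, n)).
Let N := 1%:M + G^T *m G.

Lemma dotGG (w : 'cV[R]_n) : (w^T *m (G^T *m G *m w)) 0 0 = fsq (G *m w).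
Proof. by rewrite fsq_cV trmx_mul !mulmxA. Qed.

Lemma quad_1DGG (w : 'cV[R]_n) : (w^T *m (N *m w)) 0 0 = fsq w + fsq (G *m w).
Proof.
rewrite /N mulmxDl mul1mx mulmxDr mxE -fsq_cV; congr (_ + _).
by rewrite fsq_cV trmx_mul !mulmxA.
Qed.

(** A vector in the kernel satisfies 0 = |u|^2 + |G u|^2, so it vanishes. *)
Lemma unitmx_1DGG : N \in unitmx.
Proof.
rewrite -row_free_unit -kermx_eq0; apply/eqP/row_matrixP => i; rewrite row0.
set u := row i _.
have uN : u *m N = 0 by rewrite /u -row_mul mulmx_ker row0.
have NT : N^T = N by rewrite /N linearD /= trmx1 trmx_mul trmxK.
have Nu : N *m u^T = 0 by rewrite -NT -trmx_mul uN trmx0.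
have := quad_1DGG u^T; rewrite Nu mulmx0 mxE => /esym/eqP.
rewrite paddr_eq0 ?fsq_ge0// => /andP[/eqP/fsq_eq0 u0 _].
by rewrite -[u]trmxK u0 trmx0.
Qed.

Lemma tr_1DGG : N^T = N.
Proof. by rewrite /N linearD /= trmx1 trmx_mul trmxK. Qed.

Lemma opb_resolvent : opb (invmx N) 1.
Proof.
move=> v; set w := invmx N *m v.
have -> : v = N *m w by rewrite mulKVmx ?unitmx_1DGG.
rewrite mul1r {1}/N mulmxDl mul1mx fsqDE -addrA lerDl addr_ge0 ?fsq_ge0//.
by rewrite dotGG mulr_ge0// fsq_ge0.
Qed.

(** With w = N^-1 v, |v|^2 = |w + G^T G w|^2 >= 4 <w, G^T G w> = 4 |G w|^2. *)
Lemma opb_mul_resolvent : opb (G *m invmx N) 4^-1.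
Proof.
move=> v; rewrite -mulmxA; set w := invmx N *m v.
have -> : v = N *m w by rewrite mulKVmx ?unitmx_1DGG.
rewrite {1}/N mulmxDl mul1mx fsqDE.
rewrite dotGG; have := fsq_ge0 (w - G^T *m G *m w).
by rewrite fsqDE mulmxN mxE fsqN dotGG; lra.
Qed.

(** Transposed form of [opb_mul_resolvent], by completing a square: if N w = G^T v, then |w|^2 + |G
    w|^2 = <G w, v> <= |G w|^2 + |v|^2 / 4. *)
Lemma opb_resolvent_mul : opb (invmx N *m G^T) 4^-1.
Proof.
move=> v; rewrite -mulmxA; set w := invmx N *m _.
have Nw : N *m w = G^T *m v by rewrite mulKVmx ?unitmx_1DGG.
have := quad_1DGG w; rewrite Nw mulmxA -trmx_mul => E.
have := fsq_ge0 (G *m w - 2^-1 *: v).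
by rewrite fsqDE fsqN fsqZ mulmxN mxE -scalemxAr mxE E; lra.
Qed.

End resolvent.

End fsq.

Section spectral.
Context {R : realType}.

(** The form at v + t M v is 2 t |M v|^2 + O(t^2); it can be nonnegative for all t only if M v =
    0. *)
Lemma psd_ker n (M : 'M[R]_n) (v : 'cV[R]_n) : M^T = M ->
  (forall w : 'cV[R]_n, 0 <= (w^T *m M *m w) 0 0) ->
  (v^T *m M *m v) 0 0 = 0 -> M *m v = 0.
Proof.
move=> MT Mp Mv; apply: fsq_eq0; set w := M *m v.
set c := (w^T *m M *m w) 0 0; have c0 : 0 <= c := Mp w.
set a := fsq w; have a0 : 0 <= a := fsq_ge0 w.
have key t : 0 <= 2 * t * a + t ^+ 2 * c.
  have := Mp (v + t *: w).
  rewrite [(v + _)^T]linearD /= [(t *: w)^T]linearZ /= !mulmxDl !mulmxDr.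
  rewrite -!scalemxAl -!scalemxAr !(mxDE, mxZE) Mv -/c.
  have -> : (w^T *m M *m v) 0 0 = a by rewrite -mulmxA -/w -fsq_cV.
  have -> : (v^T *m M *m w) 0 0 = a.
    by rewrite -mulmxA dotC trmx_mul MT -mulmxA -/w -fsq_cV.
  by congr (0 <= _); ring.
have u0 : 0 < c + 1 by rewrite ltr_wpDl.
(* At [t = - y] the polynomial is [- (y ^+ 2 * (c + 2))]; dividing by [c + 1] instead of [c] covers
   [c = 0]. *)
pose y := a / (c + 1); have ay : a = y * (c + 1) by rewrite /y divfK// gt_eqF.
have := key (- y); rewrite ay.
rewrite (_ : _ + _ = - (y ^+ 2 * (c + 2))); last by ring.
rewrite oppr_ge0 pmulr_lle0; last by rewrite ltr_wpDl.
move=> y2; have /eqP : y ^+ 2 = 0 by apply/eqP; rewrite eq_le y2 sqr_ge0.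
by rewrite sqrf_eq0 => /eqP ->; rewrite mul0r.
Qed.

Lemma continuous_sum_ord (T : topologicalType) N (F : 'I_N -> T -> R) :
  (forall i, continuous (F i)) -> continuous (fun x => \sum_i F i x).
Proof.
elim: N F => [|N IH] F cF.
  by under eq_fun do rewrite big_ord0; move=> x; exact: cvg_cst.
under eq_fun do rewrite big_ord_recl.
by move=> x; apply: continuousD; [exact: cF|apply: IH => i; exact: cF].
Qed.

Lemma continuous_mul (T : topologicalType) (f g : T -> R) :
  continuous f -> continuous g -> continuous (fun x => f x * g x).
Proof. by move=> cf cg x; apply: cvgM; [exact: cf|exact: cg]. Qed.

(** The quadratic form attains its maximum on the unit sphere at some u. Then f(u) 1 - A is positive
    semidefinite and its form vanishes at u, so [psd_ker] puts u in its kernel. *)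
Lemma sym_max_eigenvector n (A : 'M[R]_n.+1) : A^T = A ->
  exists (v : 'cV[R]_n.+1) (a : R), fsq v = 1 /\ A *m v = a *: v.
Proof.
move=> AT.
pose f (u : 'rV[R]_n.+1) := \sum_i \sum_j u 0 i * A i j * u 0 j.
have fE u : f u = (u *m A *m u^T) 0 0.
  rewrite mxE /f exchange_big; apply: eq_bigr => j _; rewrite !mxE mulr_suml.
  by [].
pose h (u : 'rV[R]_n.+1) := \sum_i u 0 i * u 0 i.
have hE u : h u = fsq u by rewrite /fsq big_ord1; apply: eq_bigr => i _; rewrite expr2.
have ci i : continuous (fun u : 'rV[R]_n.+1 => u 0 i) by exact: coord_continuous.
have cf : continuous f.
  apply: continuous_sum_ord => i; apply: continuous_sum_ord => j.
  apply: continuous_mul (ci j); apply: continuous_mul (ci i) _.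
  exact: cst_continuous.
have ch : continuous h.
  by apply: continuous_sum_ord => i; apply: continuous_mul; exact: ci.
pose S := [set u | h u = 1].
have Scl : closed S.
  have /continuous_closedP := ch => /(_ [set x | x = 1]); apply.
  exact: closed_eq.
have Sco : compact S.
  have Mco := @rV_compact R n.+1 (fun=> `[(- 1), 1]%classic)
    (fun _ => @segment_compact _ (-1) 1).
  apply: subclosed_compact Scl Mco _ => u /= hu i.
  rewrite in_itv /= -ler_norml -(@ler_pXn2r _ 2)// ?nnegrE// expr1n real_normK ?num_real//.
  rewrite -hu /h (bigD1 i)//= -expr2 lerDl.
  by apply: sumr_ge0 => j _; rewrite -expr2 sqr_ge0.
have S0 : S !=set0.
  exists (delta_mx 0 0); rewrite /S /= /h (bigD1 0)//= !mxE !eqxx mulr1 big1 ?addr0//.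
  by move=> i i0; rewrite !mxE (negbTE i0) mulr0.
have [u uS umax] := compact_EVT_max S0 Sco (continuous_subspaceT (A := S) cf).
move: uS; rewrite inE /S /= => hu.
have quad (w : 'rV[R]_n.+1) : f w <= f u * fsq w.
  have [w0|w0] := eqVneq (fsq w) 0.
    by rewrite w0 mulr0 fE (fsq_eq0 w0) mul0mx mul0mx mxE.
  have wp : 0 < fsq w by rewrite lt_neqAle eq_sym w0 fsq_ge0.
  set c := Num.sqrt (fsq w); have c0 : 0 < c by rewrite sqrtr_gt0.
  have c2 : c ^+ 2 = fsq w by rewrite sqr_sqrtr// ltW.
  have := umax (c^-1 *: w); rewrite inE /S /= hE fsqZ exprVn c2 mulVf// => /(_ erefl).
  rewrite (fE (_ *: _)) linearZ /= -!scalemxAl -scalemxAr scalerA mxZE -fE -expr2 exprVn c2.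
  by rewrite mulrC ler_pdivrMr.
exists u^T, (f u); split; first by rewrite fsq_tr -hE.
apply/eqP; rewrite -subr_eq0; apply/eqP.
have := @psd_ker _ ((f u)%:M - A) u^T.
rewrite linearB /= tr_scalar_mx AT => /(_ erefl) H.
apply/eqP; rewrite -oppr_eq0 opprB -mul_scalar_mx -mulmxBl; apply/eqP; apply: H.
- move=> w; rewrite mulmxBr mulmxBl mxDE mxNE.
  rewrite mul_mx_scalar -scalemxAl mxZE -fsq_cV.
  have -> : (w^T *m A *m w) 0 0 = f w^T by rewrite fE trmxK.
  by rewrite subr_ge0 (le_trans (quad _))// fsq_tr.
- rewrite mulmxBr mulmxBl mxDE mxNE trmxK.
  rewrite mul_mx_scalar -scalemxAl mxZE -fE.
  rewrite (_ : (u *m u^T) 0 0 = fsq u); last by rewrite -fsq_tr fsq_cV trmxK.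
  by rewrite -hE hu mulr1 subrr.
Qed.

(** The reflection 1 - 2 u u^T / |u|^2 with u = e - v exchanges the unit vectors e and v, since
    |u|^2 = 2 <u, e>. The case e = v is treated apart. *)
Lemma householder n (v : 'cV[R]_n.+1) : fsq v = 1 ->
  exists H : 'M[R]_n.+1, [/\ H^T = H, H *m H = 1%:M & H *m delta_mx 0 0 = v].
Proof.
move=> v1; pose e : 'cV[R]_n.+1 := delta_mx 0 0.
have e1 : fsq e = 1.
  rewrite /fsq (bigD1 0)//= big_ord1 mxE !eqxx expr1n big1 ?addr0// => i i0.
  by rewrite big_ord1 mxE (negbTE i0) expr0n.
have [<-|ev] := eqVneq e v.
  by exists 1%:M; rewrite trmx1 !mul1mx.
pose u := e - v; pose s := fsq u.
have s0 : s != 0 by apply: contra_neq ev => /fsq_eq0/eqP; rewrite subr_eq0 => /eqP.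
have uu : u^T *m u = s%:M by rewrite [LHS]mx11_scalar -fsq_cV.
have sE : s = 2 * (u^T *m e) 0 0.
  have := fsqDE (- u) e; rewrite addrC /u subKr fsqN -/u v1 e1 -/s.
  by rewrite linearN /= mulNmx mxE; lra.
exists (1%:M - (2 / s) *: (u *m u^T)); split.
- by rewrite linearB /= linearZ /= trmx1 trmx_mul trmxK.
- rewrite mulmxBl mul1mx mulmxBr mulmx1 -scalemxAl -scalemxAr mulmxA -(mulmxA u) uu.
  rewrite mul_mx_scalar -scalemxAl !scalerA.
  rewrite (_ : 2 / s * (2 / s * s) = 2 / s + 2 / s); last by field.
  by rewrite scalerDl opprB addrK subrK.
- rewrite mulmxBl mul1mx -scalemxAl -mulmxA [u^T *m _]mx11_scalar mul_mx_scalar scalerA.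
  rewrite -/e; have -> : 2 / s * (u^T *m e) 0 0 = 1.
    by rewrite mulrAC -sE mulfV.
  by rewrite scale1r /u subKr.
Qed.

(** Induction on the dimension: a reflection moves an eigenvector to the first basis vector, and
    symmetry then makes the conjugated matrix block diagonal. *)
Theorem spectral_sym n (A : 'M[R]_n) : A^T = A ->
  exists (Q : 'M[R]_n) (l : 'rV[R]_n),
    Q *m Q^T = 1%:M /\ A = Q^T *m diag_mx l *m Q.
Proof.
elim: n A => [|n IH] A AT.
  by exists 1%:M, 0; split; apply/matrixP => -[].
have [v [a [v1 Av]]] := sym_max_eigenvector AT.
have [H [HT HH He]] := householder v1.
pose B : 'M[R]_(1 + n) := H *m A *m H.
have BT : B^T = B by rewrite !trmx_mul AT HT mulmxA.
have Be : B *m delta_mx 0 0 = a *: (delta_mx 0 0 : 'cV[R]_(1 + n)).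
  by rewrite -[LHS]mulmxA He -mulmxA Av -scalemxAr -He mulmxA HH mul1mx.
have AB : A = H *m B *m H by rewrite /B !mulmxA HH mul1mx -mulmxA HH mulmx1.
clearbody B.
have E0 : 0 = lshift n (0 : 'I_1) :> 'I_(1 + n) by apply: val_inj.
have Bi0 i : B i 0 = a * (i == 0)%:R.
  have := congr1 (fun M : 'cV_(1 + n) => M i 0) Be.
  by rewrite -colE !mxE eqxx andbT.
have BE : B = block_mx a%:M 0 0 (drsubmx B).
  rewrite -[LHS]submxK; congr block_mx.
  - apply/matrixP => i j; rewrite !mxE !ord1 eqxx.
    by rewrite -E0 Bi0 eqxx mulr1 mulr1n.
  - apply/matrixP => i j; rewrite -BT !mxE !ord1 -E0 Bi0.
    by rewrite E0 -val_eqE /= mulr0.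
  - apply/matrixP => i j; rewrite !mxE !ord1 -E0 Bi0.
    by rewrite E0 -val_eqE /= mulr0.
have [|Q [l [QQ BQ]]] := IH (drsubmx B).
  by rewrite trmx_drsub BT.
pose P : 'M[R]_(1 + n) := block_mx 1%:M 0 0 Q.
pose L : 'rV[R]_(1 + n) := row_mx a%:M l.
have PP : P *m P^T = 1%:M.
  rewrite /P tr_block_mx mulmx_block !trmx0 trmx1 !(mulmx0, mul0mx, mulmx1) !addr0 !add0r QQ.
  by rewrite -scalar_mx_block.
have PB : B = P^T *m diag_mx L *m P.
  rewrite /P /L tr_block_mx !trmx0 trmx1 diag_mx_row !mulmx_block.
  rewrite !(mulmx0, mul0mx, mulmx1, mul1mx, addr0, add0r) -BQ BE; congr block_mx => //.
    by apply/matrixP => i j; rewrite !mxE !ord1 eqxx.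
  by rewrite -BE.
exists (P *m H), L; split.
- by rewrite trmx_mul HT -mulmxA (mulmxA H) HH mul1mx PP.
- by rewrite trmx_mul HT {1}AB PB !mulmxA.
Qed.

End spectral.

Section mxfun_theory.
Context {R : realType}.

Lemma orthC n (Q : 'M[R]_n) : Q *m Q^T = 1%:M -> Q^T *m Q = 1%:M.
Proof. exact: mulmx1C. Qed.

Lemma spec_sym n (Q : 'M[R]_n) (l : 'rV[R]_n) :
  (Q^T *m diag_mx l *m Q)^T = Q^T *m diag_mx l *m Q.
Proof. by rewrite !trmx_mul tr_diag_mx trmxK mulmxA. Qed.

Lemma mul_spec n (Q : 'M[R]_n) (l m : 'rV[R]_n) : Q *m Q^T = 1%:M ->
  (Q^T *m diag_mx l *m Q) *m (Q^T *m diag_mx m *m Q) =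
  Q^T *m diag_mx (\row_i (l 0 i * m 0 i)) *m Q.
Proof.
move=> QQ; rewrite -!mulmxA (mulmxA Q) QQ mul1mx !mulmxA -(mulmxA Q^T).
by rewrite mulmx_diag.
Qed.

Lemma spec_quad n (Q : 'M[R]_n) (l : 'rV[R]_n) i : Q *m Q^T = 1%:M ->
  let v := Q^T *m delta_mx i 0 : 'cV[R]_n in
  fsq v = 1 /\ (v^T *m (Q^T *m diag_mx l *m Q) *m v) 0 0 = l 0 i.
Proof.
move=> QQ v; split.
  rewrite fsq_cV /v trmx_mul trmxK -mulmxA (mulmxA Q) QQ mul1mx.
  by rewrite trmx_delta mul_delta_mx mxE !eqxx.
rewrite /v trmx_mul trmxK -!mulmxA !(mulmxA Q) QQ !mul1mx trmx_delta.
by rewrite -rowE -colE !mxE eqxx mulr1n.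
Qed.

(** The set in [mxfun] is inhabited by [spectral_sym], which excludes the default value 0; later
    proofs work with the diagonalization that [xget] happens to select. *)
Lemma mxfunP n (f : R -> R) (A : 'M[R]_n) : A^T = A ->
  exists (Q : 'M[R]_n) (l : 'rV[R]_n), [/\ Q *m Q^T = 1%:M,
    A = Q^T *m diag_mx l *m Q &
    mxfun f A = Q^T *m diag_mx (map_mx f l) *m Q].
Proof.
move=> AT; rewrite /mxfun; set P := (P in xget _ P).
have [Q [l [QQ AE]]] := spectral_sym AT.
have PQ : P (Q^T *m diag_mx (map_mx f l) *m Q) by exists Q, l; split.
have [Q1 [l1 [? ? ?]]] := @xgetPex _ 0 P (ex_intro _ _ PQ).
by exists Q1, l1; split.
Qed.

Lemma fsq0 m n : fsq (0 : 'M[R]_(m, n)) = 0.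
Proof. by rewrite /fsq big1// => i _; rewrite big1// => j _; rewrite mxE expr0n. Qed.

Lemma posdef_spec n (Q : 'M[R]_n) (l : 'rV[R]_n) : Q *m Q^T = 1%:M ->
  posdef (Q^T *m diag_mx l *m Q) -> forall i, 0 < l 0 i.
Proof.
move=> QQ [_ pA] i; have [v1 <-] := spec_quad l i QQ; apply: pA.
by apply/eqP => v0; move/eqP: v1; rewrite v0 fsq0 eq_sym oner_eq0.
Qed.

Lemma fsq_gt0 m n (A : 'M[R]_(m, n)) : A != 0 -> 0 < fsq A.
Proof.
by move=> A0; rewrite lt_neqAle fsq_ge0 andbT eq_sym; apply: contra_neq A0 => /fsq_eq0.
Qed.

Lemma posdef_unit n (A : 'M[R]_n) : posdef A -> A \in unitmx.
Proof.
move=> pA; have [Q [l [QQ AE]]] := spectral_sym (proj1 pA).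
have l0 : forall i, 0 < l 0 i by apply: (posdef_spec QQ); rewrite -AE.
have : A *m (Q^T *m diag_mx (\row_i (l 0 i)^-1) *m Q) = 1%:M.
  rewrite {1}AE mul_spec// (_ : diag_mx _ = 1%:M) ?mulmx1 ?orthC//.
  apply/matrixP => i j; rewrite !mxE divff//.
  by rewrite gt_eqF.
by move=> /mulmx1_unit [].
Qed.

Lemma posdef_inv n (A : 'M[R]_n) : posdef A -> posdef (invmx A).
Proof.
move=> pA; have uA := posdef_unit pA; split; first by rewrite trmx_inv (proj1 pA).
move=> v v0; have w0 : invmx A *m v != 0.
  by apply: contra_neq v0 => w0; rewrite -(mulKVmx uA v) w0 mulmx0.
have := proj2 pA _ w0.
by rewrite trmx_mul trmx_inv (proj1 pA) -!mulmxA mulKVmx.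
Qed.

Lemma sqrtmxP n (A : 'M[R]_n) : posdef A ->
  [/\ (sqrtmx A)^T = sqrtmx A, sqrtmx A *m sqrtmx A = A & sqrtmx A \in unitmx].
Proof.
move=> pA; have [Q [l [QQ AE SE]]] := mxfunP Num.sqrt (proj1 pA).
have l0 : forall i, 0 < l 0 i by apply: (posdef_spec QQ); rewrite -AE.
have SS : sqrtmx A *m sqrtmx A = A.
  rewrite /sqrtmx SE mul_spec// [RHS]AE; congr (_ *m diag_mx _ *m _).
  by apply/rowP => i; rewrite !mxE -expr2 sqr_sqrtr// ltW.
split => //; first by rewrite /sqrtmx SE spec_sym.
have := posdef_unit pA; rewrite -{1}SS unitmx_mul => /andP[] //.
Qed.

Lemma fsq_spec n (Q : 'M[R]_n) (l : 'rV[R]_n) : Q *m Q^T = 1%:M ->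
  fsq (Q^T *m diag_mx l *m Q) = \sum_i l 0 i ^+ 2.
Proof. by move=> QQ; rewrite fsq_orthr// fsq_orthl ?trmxK// fsq_diag. Qed.

Lemma opb_spec n (Q : 'M[R]_n) (l : 'rV[R]_n) c : Q *m Q^T = 1%:M ->
  (forall i, l 0 i ^+ 2 <= c) -> opb (Q^T *m diag_mx l *m Q) c.
Proof.
move=> QQ lc v; rewrite -!mulmxA fsq_orthl ?trmxK//.
rewrite -(fsq_orthl v (orthC QQ)) /fsq mulr_sumr; apply: ler_sum => i _.
by rewrite !big_ord1 mul_diag_mx mxE exprMn ler_wpM2r ?sqr_ge0.
Qed.

End mxfun_theory.

Section opnorm.
Context {R : realType}.

Lemma opnorm_le n (A : 'M[R]_n) c : 0 <= c -> opb A (c ^+ 2) -> opnorm A <= c.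
Proof.
move=> c0 Ac; apply: ge_sup.
  by exists (frobenius (A *m (0 : 'cV[R]_n))), 0 => //=; rewrite frobeniusE fsq0 sqrtr0.
move=> _ [v /= v1 <-]; rewrite frobeniusE -(ger0_norm c0) -sqrtr_sqr ler_wsqrtr//.
rewrite (le_trans (Ac v))// ler_piMr ?sqr_ge0//.
by rewrite -(@ler_sqrt _ _ 1)// sqrtr1.
Qed.

Lemma frobenius_le_opnorm n (A : 'M[R]_n) (v : 'cV[R]_n) :
  fsq v <= 1 -> frobenius (A *m v) <= opnorm A.
Proof.
(* A crude Cauchy-Schwarz bound; it shows that the set defining [opnorm] is bounded above, so that
   [sup] is a true supremum. *)
have bdA (w : 'cV[R]_n) : fsq w <= 1 -> fsq (A *m w) <= n%:R * fsq A.
  move=> w1; rewrite /fsq mulr_sumr; apply: ler_sum => i _; rewrite big_ord1 mxE.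
  apply: (le_trans (sqr_sum_le _)); rewrite ler_wpM2l//; apply: ler_sum => j _.
  rewrite exprMn ler_piMr ?sqr_ge0//; apply: le_trans w1.
  rewrite /fsq (bigD1 j)//= big_ord1 lerDl; apply: sumr_ge0 => k _.
  by apply: sumr_ge0 => l _; rewrite sqr_ge0.
have le1 (w : 'cV[R]_n) : fsq w <= 1 -> frobenius w <= 1.
  by move=> w1; rewrite frobeniusE -sqrtr1 ler_wsqrtr.
move=> v1; apply: sup_upper_bound; last by exists v => //=; exact: le1.
split; first by exists (frobenius (A *m v)), v => //=; exact: le1.
exists (Num.sqrt (n%:R * fsq A)) => _ [w /= w1 <-].
rewrite frobeniusE ler_wsqrtr// bdA//.
by rewrite -(@ler_sqrt _ _ 1)// sqrtr1.
Qed.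

Lemma opnorm_ge0 n (A : 'M[R]_n) : 0 <= opnorm A.
Proof.
apply: (le_trans (sqrtr_ge0 _) (@frobenius_le_opnorm _ A 0 _)).
by rewrite fsq0.
Qed.

(** Each of the [n] columns is the image of a unit vector. *)
Lemma fsq_le_opnorm n (A : 'M[R]_n) : fsq A <= n%:R * opnorm A ^+ 2.
Proof.
have key (v : 'cV[R]_n) : fsq v <= 1 -> fsq (A *m v) <= opnorm A ^+ 2.
  move=> /(frobenius_le_opnorm A) fA; rewrite -[leLHS]sqr_sqrtr ?fsq_ge0//.
  by rewrite ler_pXn2r// nnegrE ?sqrtr_ge0 ?opnorm_ge0.
rewrite fsq_col mulr_natl -[X in _ *+ X]card_ord -sumr_const; apply: ler_sum => j _.
rewrite colE; apply: key; rewrite /fsq (bigD1 j)//= big_ord1 mxE !eqxx expr1n.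
by rewrite big1 ?addr0// => i ij; rewrite big_ord1 mxE (negbTE ij) expr0n.
Qed.

End opnorm.

(** * Affine-invariant distances and resolvents *)

Section distances.
Context {R : realType}.

Definition res n (A : 'M[R]_n) : 'M[R]_n := invmx (1%:M + A).

Lemma expR_sub_le (x : R) : `|x| <= 2^-1 ->
  (expR x - expR (- x)) ^+ 2 <= 16 * x ^+ 2.
Proof.
have pos (y : R) : 0 <= y -> y <= 2^-1 -> 0 <= expR y - expR (- y) <= 4 * y.
  move=> y0 y1; have e1 := expR_ge1Dx (- y); have e2 := expR_ge1Dx y.
  have e3 : expR (- y) <= 1 by rewrite -expR0 ler_expR oppr_le0.
  have e4 : expR y * expR (- y) = 1 by rewrite -expRD subrr expR0.
  have e5 := expR_gt0 y.
  apply/andP; split; first by lra.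
  (* From expR (- y) >= 1 - y comes expR y (1 - y) <= 1, and 1 <= (1 + 2 y) (1 - y) for 0 <= y <=
     1/2. *)
  suff : expR y <= 1 + 2 * y by lra.
  have : expR y * (1 - y) <= 1 by rewrite -e4; nra.
  move=> h; rewrite -(@ler_pM2r _ (1 - y)); last by lra.
  by apply: (le_trans h); nra.
wlog x0 : x / 0 <= x.
  move=> H; have [x0|x0] := leP 0 x; first exact: H.
  move=> x1; have := H (- x).
  rewrite oppr_ge0 normrN opprK sqrrN -(opprB (expR x)) sqrrN; apply => //.
  exact: ltW.
rewrite ger0_norm// => x1; have /andP[a b] := pos x x0 x1.
rewrite (_ : 16 * _ = (4 * x) ^+ 2); last by ring.
by rewrite ler_pXn2r// nnegrE mulr_ge0.
Qed.

(** One short step of the geodesic. With E = exp(diag x) and F its inverse, N' - N = G^T (E - F) G',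
    so the resolvents differ by (N^-1 G^T) (E - F) (G' N'^-1). The outer factors contribute 1/4
    each, which absorbs the 16 of [expR_sub_le]. *)
Lemma res_step n (G : 'M[R]_n) (x : 'rV[R]_n) (G' := diag_mx (map_mx expR x) *m G) :
  (forall i, `|x 0 i| <= 2^-1) ->
  fsq (res (G^T *m G) - res (G'^T *m G')) <= \sum_i x 0 i ^+ 2.
Proof.
move=> x1; pose N := 1%:M + G^T *m G; pose N' := 1%:M + G'^T *m G'.
pose E := diag_mx (map_mx expR x); pose F := diag_mx (map_mx expR (- x)).
have uN : N \in unitmx by exact: unitmx_1DGG.
have uN' : N' \in unitmx by exact: unitmx_1DGG.
have FE : F *m E = 1%:M.
  rewrite mulmx_diag; apply/matrixP => i j; rewrite !mxE -expRD addNr expR0.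
  by [].
have NN : N' - N = G^T *m (E - F) *m G'.
  rewrite /N /N' opprD addrACA subrr add0r mulmxBr mulmxBl; congr (_ - _).
    by rewrite {1}/G' trmx_mul tr_diag_mx.
  by rewrite /G' -!mulmxA (mulmxA F) FE mul1mx.
have -> : res (G^T *m G) - res (G'^T *m G') =
    (invmx N *m G^T) *m ((E - F) *m (G' *m invmx N')).
  rewrite /res -/N -/N'.
  have -> : invmx N - invmx N' = invmx N *m (N' - N) *m invmx N'.
    by rewrite mulmxBr mulmxBl mulVmx// mul1mx -mulmxA mulmxV// mulmx1.
  by rewrite NN !mulmxA.
apply: (le_trans (opb_mull _ (opb_resolvent_mul G))).
have : fsq ((E - F) *m (G' *m invmx N')) <= 4^-1 * fsq (E - F).
  apply: opb_mulr; rewrite trmx_mul trmx_inv tr_1DGG; exact: opb_resolvent_mul.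
have EF : fsq (E - F) <= 16 * \sum_i x 0 i ^+ 2.
  rewrite /E /F -linearB /= fsq_diag mulr_sumr; apply: ler_sum => i _.
  by rewrite !mxE; exact: expR_sub_le.
lra.
Qed.

Lemma d_FRE n (A B : 'M[R]_n) : d_FR A B ^+ 2 = 2^-1 * fsq (rel_log A B).
Proof. by rewrite /d_FR exprMn exprVn !sqr_sqrtr ?fsq_ge0. Qed.

(** The geodesic is cut into [m] equal pieces, each changing the resolvent by at most L / (4 m^2) in
    squared norm; by Cauchy-Schwarz the total change is at most L / 4, which is half of
    [d_FR A B ^+ 2]. *)
Lemma res_le_d_FR n (A B : 'M[R]_n) : posdef A -> posdef B ->
  2 * fsq (res A - res B) <= d_FR A B ^+ 2.
Proof.
move=> pA pB; have [ST SS uS] := sqrtmxP pA; set S := sqrtmx A in ST SS uS.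
pose Y := invmx S *m B *m invmx S.
have YT : Y^T = Y by rewrite !trmx_mul !trmx_inv ST (proj1 pB) mulmxA.
have [Q [l [QQ YE LE]]] := mxfunP (@ln R) YT.
have pY : posdef Y.
  split => // v v0; have w0 : invmx S *m v != 0.
    by apply: contra_neq v0 => w0; rewrite -(mulKVmx uS v) w0 mulmx0.
  by have := proj2 pB _ w0; rewrite trmx_mul trmx_inv ST !mulmxA.
have l0 : forall i, 0 < l 0 i by apply: (posdef_spec QQ); rewrite -YE.
pose el i := ln (l 0 i).
rewrite d_FRE; have -> : fsq (rel_log A B) = \sum_i el i ^+ 2.
  rewrite /rel_log -/S -/Y /logmx LE fsq_spec//.
  by apply: eq_bigr => i _; rewrite mxE.
set L := \sum_i _.
have sl0 : 0 <= \sum_i `|el i| by apply: sumr_ge0.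
(* Large enough for every step [el i / (2 * m%:R)] to be at most 1/2, as [res_step] requires. *)
pose m := (Num.bound (\sum_i `|el i|)).+1.
have mb i : `|el i| <= m%:R.
  have := archi_boundP sl0; rewrite {1}(bigD1 i)//= -/m => /ltW h.
  have s0 : 0 <= \sum_(j | j != i) `|el j| by apply: sumr_ge0.
  by rewrite /m -natr1; lra.
have m0 : 0 < m%:R :> R by rewrite ltr0n.
pose x : 'rV[R]_n := \row_i (el i / (2 * m%:R)).
(* (G k)^T (G k) is S Y^(k/m) S, the point at fraction k/m of the geodesic from A to B; the 2 in the
   denominator of [x] is there because [G] enters twice. *)
pose G (k : nat) : 'M[R]_n := diag_mx (map_mx expR (k%:R *: x)) *m (Q *m S).
have GS k : G k.+1 = diag_mx (map_mx expR x) *m G k.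
  rewrite /G [RHS]mulmxA mulmx_diag; congr (diag_mx _ *m _).
  by apply/rowP => i; rewrite !mxE -expRD -natr1; congr expR; ring.
have G0 : (G 0%N)^T *m G 0%N = A.
  rewrite /G scale0r (_ : diag_mx _ = 1%:M).
    by rewrite mul1mx trmx_mul ST mulmxA -(mulmxA S) orthC// mulmx1.
  by apply/matrixP => i j; rewrite !mxE expR0.
have Gm : (G m)^T *m G m = B.
  rewrite /G trmx_mul tr_diag_mx -!mulmxA (mulmxA (diag_mx _)) mulmx_diag.
  rewrite trmx_mul ST (_ : diag_mx _ = diag_mx l).
    have -> : S *m Q^T *m (diag_mx l *m (Q *m S)) = S *m Y *m S by rewrite YE !mulmxA.
    by rewrite /Y !mulmxA mulmxV// mul1mx -mulmxA mulVmx// mulmx1.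
  congr diag_mx; apply/rowP => i; rewrite !mxE -expRD.
  rewrite (_ : _ + _ = el i); first by rewrite /el lnK// posrE.
  by field; rewrite gt_eqF.
have tele : res A - res B = \sum_(k < m) (res ((G k)^T *m G k) - res ((G k.+1)^T *m G k.+1)).
  rewrite -G0 -Gm -(big_mkord xpredT (fun k => res ((G k)^T *m G k) - res ((G k.+1)^T *m G k.+1))).
  have T := telescope_sumr (fun k => res ((G k)^T *m G k)) (leq0n m).
  rewrite -[LHS]opprB -[X in - X]T -sumrN.
  by apply: eq_bigr => k _; rewrite opprB.
have stepk k : fsq (res ((G k)^T *m G k) - res ((G k.+1)^T *m G k.+1)) <= \sum_i x 0 i ^+ 2.
  rewrite GS; apply: res_step => i; rewrite mxE normrM normfV (@ger0_norm _ (2 * _)) ?mulr_ge0//.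
  rewrite ler_pdivrMr ?mulr_gt0// mulrA mulVf ?mul1r//.
rewrite tele; apply: (@le_trans _ _ (2 * (m%:R * \sum_(k < m) \sum_i x 0 i ^+ 2))).
  rewrite ler_wpM2l//; apply: (le_trans (fsq_sum_le _)); rewrite ler_wpM2l//.
  exact: ler_sum.
rewrite sumr_const card_ord -mulr_natl.
have -> : \sum_i x 0 i ^+ 2 = L / (2 * m%:R) ^+ 2.
  by rewrite /L mulr_suml; apply: eq_bigr => i _; rewrite mxE expr_div_n.
rewrite le_eqVlt; apply/orP; left; apply/eqP; field.
by rewrite gt_eqF.
Qed.

Lemma d_FR_le_d_op n (A B : 'M[R]_n) : 2 * d_FR A B ^+ 2 <= n%:R * d_op A B ^+ 2.
Proof. by rewrite d_FRE mulrA mulfV// mul1r; exact: fsq_le_opnorm. Qed.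

(** Here the relative logarithm is that of A^-1. Its eigenvalues lie in [1/2, 2], and ln t <= t - 1,
    applied to an eigenvalue and to its inverse, bounds their logarithms by 1. *)
Lemma d_op1_le1 n (A : 'M[R]_n) : posdef A ->
  (forall v : 'cV[R]_n, 2^-1 * fsq v <= (v^T *m A *m v) 0 0 <= 2 * fsq v) ->
  d_op A 1%:M <= 1.
Proof.
move=> pA qA; have [ST SS uS] := sqrtmxP pA; set S := sqrtmx A in ST SS uS.
pose Y := invmx S *m 1%:M *m invmx S.
have YT : Y^T = Y by rewrite !trmx_mul !trmx_inv ST trmx1 mulmxA.
have [Q [l [QQ YE LE]]] := mxfunP (@ln R) YT.
rewrite /d_op /rel_log -/S -/Y /logmx LE; apply: opnorm_le => //.
apply: opb_spec => // i; rewrite mxE expr1n.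
have [u1] := spec_quad l i QQ; set u := _ *m _ in u1 *; rewrite -YE /Y mulmx1 => li.
clearbody u; pose w := invmx S *m u.
have lw : l 0 i = fsq w.
  by rewrite -li fsq_cV /w trmx_mul trmx_inv ST !mulmxA.
have wA : (w^T *m A *m w) 0 0 = 1.
  rewrite -SS /w trmx_mul trmx_inv ST -!mulmxA !mulKVmx// mulKmx//.
  by rewrite -fsq_cV.
have /andP[] := qA w; rewrite wA -lw => h1 h2.
have li0 : 0 < l 0 i by lra.
rewrite -(real_normK (num_real _)) -[X in _ <= X](expr1n _ 2) ler_pXn2r// ?nnegrE//.
rewrite ler_norml; apply/andP; split.
  have h3 : 0 < (l 0 i)^-1 by rewrite invr_gt0.
  have h4 : (l 0 i)^-1 <= 2 by rewrite invf_ple ?posrE//; lra.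
  have := @le_ln1Dx R ((l 0 i)^-1 - 1).
  rewrite (_ : 1 + _ = (l 0 i)^-1); last by ring.
  by rewrite lnV ?posrE// => /(_ ltac:(lra)); lra.
have := @le_ln1Dx R (l 0 i - 1).
rewrite (_ : 1 + _ = l 0 i); last by ring.
by move=> /(_ ltac:(lra)); lra.
Qed.

End distances.

(** * A family of determinant-one matrices *)

Section trunc.
Context {R : realType} (p q : nat) (h : R).
Hypothesis h0 : 0 < h.
Implicit Types B : 'M[R]_(p, q).

(* Shrinks the large singular values of [B], so that the operator norm is at most
   [1 / (2 h)] whatever [B] is. *)
Definition trunc B : 'M[R]_(p, q) :=
  h^-1 *: ((h *: B) *m invmx (1%:M + (h *: B)^T *m (h *: B))).

Let inv_sqr_double : (2 * h) ^- 2 = h^-1 ^+ 2 * 4^-1.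
Proof. by field; rewrite gt_eqF. Qed.

Lemma opb_trunc B : opb (trunc B) ((2 * h) ^- 2).
Proof.
move=> v; rewrite /trunc -(scalemxAl h^-1) fsqZ.
have := opb_mul_resolvent (h *: B) v => le4.
by rewrite inv_sqr_double -(mulrA (h^-1 ^+ 2)) ler_wpM2l ?sqr_ge0.
Qed.

Lemma opb_trunc_tr B : opb (trunc B)^T ((2 * h) ^- 2).
Proof.
move=> v; rewrite /trunc linearZ /= trmx_mul trmx_inv tr_1DGG -(scalemxAl h^-1) fsqZ.
have := opb_resolvent_mul (h *: B) v => le4.
by rewrite inv_sqr_double -(mulrA (h^-1 ^+ 2)) ler_wpM2l ?sqr_ge0.
Qed.

Lemma fsq_trunc B : fsq (trunc B) <= fsq B.
Proof.
rewrite /trunc fsqZ.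
have : fsq ((h *: B) *m invmx (1%:M + (h *: B)^T *m (h *: B))) <= 1 * fsq (h *: B).
  by apply: opb_mulr; rewrite trmx_inv tr_1DGG; exact: opb_resolvent.
rewrite mul1r fsqZ exprVn => le1.
by rewrite ler_pdivrMl// exprn_gt0.
Qed.

(** With G = h B and N = 1 + G^T G, B - B N^-1 = B N^-1 (N - 1) = h (G N^-1) (B^T B), and
    [opb_mul_resolvent] bounds G N^-1. *)
Lemma fsq_sub_trunc B : fsq (B - trunc B) <= h ^+ 2 / 4 * fsq (B^T *m B).
Proof.
pose G := h *: B; pose N := 1%:M + G^T *m G.
have uN : N \in unitmx by exact: unitmx_1DGG.
have -> : B - trunc B = h *: ((G *m invmx N) *m (B^T *m B)).
  have -> : B^T *m B = h^-1 *: (h^-1 *: (N - 1%:M)).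
    rewrite /N addrAC subrr add0r /G [(h *: B)^T]linearZ /= -scalemxAl -scalemxAr !scalerA.
    by rewrite (_ : _ * h = 1) ?scale1r//; field; rewrite gt_eqF.
  rewrite -2!(scalemxAr h^-1) (scalerA h) divff ?gt_eqF// scale1r.
  rewrite mulmxBr mulmx1 -mulmxA mulVmx// mulmx1.
  by rewrite scalerBr {1}/G scalerA mulVf ?gt_eqF// scale1r.
rewrite fsqZ -mulrA ler_wpM2l ?sqr_ge0//.
exact: (opb_mull _ (opb_mul_resolvent G)).
Qed.

End trunc.

Section theta.
Context {R : realType} (p q : nat) (h e : R).
Hypothesis h0 : 0 < h.
Hypothesis e0 : 0 < e.
Hypothesis eh : 4 * e <= h.
Implicit Types B : 'M[R]_(p, q).

Lemma fsq_block m1 m2 n1 n2 (A : 'M[R]_(m1, n1)) (B : 'M[R]_(m1, n2))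
    (C : 'M[R]_(m2, n1)) (E : 'M[R]_(m2, n2)) :
  fsq (block_mx A B C E) = fsq A + fsq B + (fsq C + fsq E).
Proof.
rewrite /fsq big_split_ord /= -!big_split /=.
by congr (_ + _); apply: eq_bigr => i _; rewrite big_split_ord /=; congr (_ + _);
  apply: eq_bigr => j _; rewrite (block_mxEul, block_mxEur, block_mxEdl, block_mxEdr).
Qed.

Lemma fsq_col_mx m1 m2 n (A : 'M[R]_(m1, n)) (B : 'M[R]_(m2, n)) :
  fsq (col_mx A B) = fsq A + fsq B.
Proof.
rewrite /fsq big_split_ord /=.
by congr (_ + _); apply: eq_bigr => i _; apply: eq_bigr => j _;
  rewrite (col_mxEu, col_mxEd).
Qed.

Definition shear_fact B : 'M[R]_(p + q) := block_mx 1%:M (e *: trunc h B) 0 1%:M.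

Definition theta B : 'M[R]_(p + q) := (shear_fact B)^T *m shear_fact B.

Lemma theta_det B : \det (theta B) = 1.
Proof. by rewrite det_mulmx det_tr /shear_fact det_ublock !det1 !mulr1. Qed.

Lemma theta_sym B : (theta B)^T = theta B.
Proof. by rewrite trmx_mul trmxK. Qed.

(** The block e T has operator norm at most e / (2 h) <= 1/8, so the shear changes |v|^2 little. *)
Lemma theta_quad B (v : 'cV[R]_(p + q)) :
  3 / 4 * fsq v <= (v^T *m theta B *m v) 0 0 <= 2 * fsq v.
Proof.
have -> : (v^T *m theta B *m v) 0 0 = fsq (shear_fact B *m v).
  by rewrite fsq_cV trmx_mul /theta !mulmxA.
rewrite -[v]vsubmxK; set x := usubmx v; set y := dsubmx v.
rewrite /shear_fact mul_block_col !mul1mx mul0mx add0r !fsq_col_mx.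
set w := e *: trunc h B *m y.
have wy : 64 * fsq w <= fsq y.
  rewrite /w -scalemxAl fsqZ mulrA.
  apply: (@le_trans _ _ (64 * e ^+ 2 * ((2 * h) ^- 2 * fsq y))).
    apply: ler_wpM2l; last exact: (opb_trunc h0 B y).
    by rewrite pmulr_rge0 ?sqr_ge0.
  rewrite mulrA ler_piMl ?fsq_ge0// ler_pdivrMr ?exprn_gt0 ?mulr_gt0// mul1r.
  rewrite (_ : 64 * e ^+ 2 = (8 * e) ^+ 2); last by ring.
  by rewrite ler_pXn2r// ?nnegrE; move: e0 eh h0; lra.
(* The weight 8 matches [64 * fsq w <= fsq y]: the cross term satisfies 2 |<x, w>| <= (|x|^2 + 64
   |w|^2) / 8. *)
have := fsq_ge0 (x - 8 *: w); have := fsq_ge0 (x + 8 *: w).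
rewrite !fsqDE fsqN fsqZ mulmxN -scalemxAr mxNE mxZE.
have := fsq_ge0 w; have := fsq_ge0 x; have := fsq_ge0 y.
by move=> ? ? ? ? ?; apply/andP; split; lra.
Qed.

Lemma theta_posdef B : posdef (theta B).
Proof.
split=> [|v v0]; first exact: theta_sym.
have /andP[+ _] := theta_quad B v; apply: lt_le_trans.
by rewrite mulr_gt0// fsq_gt0.
Qed.

(** The nonzero blocks of theta - 1 are e T, its transpose and (e T)^T (e T); the last is no larger
    than e T, whose operator norm is at most 1. Hence the factor 3. *)
Lemma theta_sub1 B : fsq (theta B - 1%:M) <= 3 * e ^+ 2 * fsq B.
Proof.
pose T := trunc h B.
have -> : theta B - 1%:M = block_mx 0 (e *: T) (e *: T)^T ((e *: T)^T *m (e *: T)).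
  rewrite /theta /shear_fact tr_block_mx !trmx1 trmx0 mulmx_block.
  rewrite !(mul1mx, mulmx1, mul0mx, mulmx0, addr0, add0r) -/T.
  by rewrite scalar_mx_block opp_block_mx add_block_mx !subr0 subrr addrK.
rewrite fsq_block fsq0 add0r fsq_tr.
have : fsq ((e *: T)^T *m (e *: T)) <= fsq (e *: T).
  apply: (le_trans (@opb_mull _ _ _ _ _ _ 1 _)); last by rewrite mul1r.
  move=> v; rewrite linearZ /= -scalemxAl fsqZ mul1r.
  apply: (@le_trans _ _ (e ^+ 2 * ((2 * h) ^- 2 * fsq v))).
    by rewrite ler_wpM2l ?sqr_ge0//; exact: (opb_trunc_tr h0 B v).
  rewrite mulrA ler_piMl ?fsq_ge0// ler_pdivrMr ?exprn_gt0 ?mulr_gt0// mul1r.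
  by rewrite ler_pXn2r// ?nnegrE; move: e0 eh h0; lra.
have : fsq (e *: T) <= e ^+ 2 * fsq B.
  by rewrite fsqZ ler_wpM2l ?sqr_ge0//; exact: fsq_trunc.
lra.
Qed.

(** The two off-diagonal blocks alone give the bound. *)
Lemma theta_sub B B' :
  2 * e ^+ 2 * fsq (trunc h B - trunc h B') <= fsq (theta B - theta B').
Proof.
pose T := trunc h B; pose T' := trunc h B'.
have E C : theta C = block_mx 1%:M (e *: trunc h C) (e *: trunc h C)^T
     ((e *: trunc h C)^T *m (e *: trunc h C) + 1%:M).
  rewrite /theta /shear_fact tr_block_mx !trmx1 trmx0 mulmx_block.
  by rewrite !(mul1mx, mulmx1, mul0mx, mulmx0, addr0, add0r).
rewrite !E opp_block_mx add_block_mx fsq_block subrr fsq0 add0r.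
set X := e *: trunc h B; set Y := e *: trunc h B'.
have -> : X^T - Y^T = (X - Y)^T by rewrite linearB.
have XY : X - Y = e *: (T - T') by rewrite scalerBr.
rewrite fsq_tr XY fsqZ -/T -/T'.
set z := fsq (_ - _); set t := fsq _.
have : 0 <= t by exact: fsq_ge0.
lra.
Qed.

End theta.

Section res_lower.
Context {R : realType}.

Lemma opb_1D n (A : 'M[R]_n) : A^T = A ->
  (forall v : 'cV[R]_n, 0 <= (v^T *m A *m v) 0 0 <= 2 * fsq v) ->
  opb (1%:M + A) 9.
Proof.
move=> AT qA; have [|Q [l [QQ AE]]] := @spectral_sym R n (1%:M + A).
  by rewrite linearD /= trmx1 AT.
rewrite AE; apply: opb_spec => // i.
have [u1 <-] := spec_quad l i QQ; rewrite -AE; set u := _ *m _ in u1 *.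
have /andP[] := qA u; rewrite mulmxDr mulmx1 mulmxDl mxDE -fsq_cV u1.
by nra.
Qed.

Lemma unitmx_1D n (A : 'M[R]_n) : posdef A -> 1%:M + A \in unitmx.
Proof.
move=> [AT Ap]; apply: posdef_unit; split; first by rewrite linearD /= trmx1 AT.
move=> v v0; rewrite mulmxDr mulmx1 mulmxDl mxDE -fsq_cV.
by rewrite ltr_wpDl ?fsq_ge0//; exact: Ap.
Qed.

(** A - B = (1 + A) (res B - res A) (1 + B), and the outer factors have operator norm at most 3,
    whence 81 = 9 * 9. *)
Lemma fsq_sub_le_res n (A B : 'M[R]_n) : posdef A -> posdef B ->
  (forall v : 'cV[R]_n, 0 <= (v^T *m A *m v) 0 0 <= 2 * fsq v) ->
  (forall v : 'cV[R]_n, 0 <= (v^T *m B *m v) 0 0 <= 2 * fsq v) ->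
  fsq (A - B) <= 81 * fsq (res A - res B).
Proof.
move=> pA pB qA qB.
have -> : A - B = (1%:M + A) *m ((res B - res A) *m (1%:M + B)).
  rewrite mulmxBl mulmxBr mulVmx ?unitmx_1D// mulmxA mulmxV ?unitmx_1D// mul1mx mulmx1.
  by rewrite opprD addrACA subrr add0r.
apply: (le_trans (opb_mull _ (opb_1D (proj1 pA) qA))).
have : fsq ((res B - res A) *m (1%:M + B)) <= 9 * fsq (res B - res A).
  by apply: opb_mulr; rewrite linearD /= trmx1 (proj1 pB); exact: opb_1D (proj1 pB) qB.
by rewrite (fsqB (res A)); lra.
Qed.

End res_lower.

(** * Matrices on a grid: fourth moments and Hamming balls *)

Section hypercube.
Context {R : realType} (p q : nat).
Hypothesis p0 : (0 < p)%N.
Hypothesis pq : (p <= q)%N.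

(* With 128 letters instead of 2, the Hamming balls counted below have density at most
   [32 ^- N], which is small enough already for [N = 1], that is for 2 x 2 matrices. *)
Definition aval (t : 'I_128) : R := ((2 * t)%:R - 127) / 128.

Lemma aval_rev t : aval (rev_ord t) = - aval t.
Proof.
rewrite /aval /= !natrM natrB; last exact: ltn_ord.
by rewrite -natr1; lra.
Qed.

Lemma aval_sqr_le t : aval t ^+ 2 <= 1.
Proof.
have h1 : t%:R <= 127 :> R by rewrite (ler_nat _ _ 127) -ltnS.
have h2 : 0 <= t%:R :> R by [].
by rewrite /aval natrM; nra.
Qed.

Lemma aval_sub t u : t != u -> 64 ^- 2 <= (aval t - aval u) ^+ 2.
Proof.
rewrite neq_ltn /aval => /orP[] tu.
- have : t%:R + 1 <= u%:R :> R by rewrite natr1 ler_nat.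
  by rewrite !natrM; nra.
- have : u%:R + 1 <= t%:R :> R by rewrite natr1 ler_nat.
  by rewrite !natrM; nra.
Qed.

Definition grid := {ffun 'I_p * 'I_q -> 'I_128}.

Definition gmx (tau : grid) : 'M[R]_(p, q) :=
  \matrix_(i, j) (aval (tau (i, j)) / Num.sqrt q%:R).

Let q0 : 0 < q%:R :> R. Proof. by rewrite ltr0n (leq_trans p0). Qed.

Let sq : Num.sqrt q%:R ^+ 2 = q%:R :> R. Proof. by rewrite sqr_sqrtr// ltW. Qed.

Lemma fsq_gmx tau : fsq (gmx tau) <= p%:R.
Proof.
have -> : p%:R = \sum_(i < p) \sum_(j < q) (q%:R^-1 : R).
  rewrite !sumr_const !card_ord -[_ *+ q]mulr_natl mulfV ?gt_eqF//.
apply: ler_sum => i _; apply: ler_sum => j _.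
rewrite mxE expr_div_n sq ler_pdivrMr// mulVf ?gt_eqF//.
exact: aval_sqr_le.
Qed.

(** Reverses the sign of the entry [x], since [rev_ord] negates [aval]: the symmetry that cancels
    mixed moments. *)
Definition flip (x : 'I_p * 'I_q) (tau : grid) : grid :=
  [ffun y => if y == x then rev_ord (tau y) else tau y].

Lemma flipK x : involutive (flip x).
Proof.
by move=> tau; apply/ffunP => y; rewrite !ffunE; case: eqP => // _; rewrite rev_ordK.
Qed.

(** If i and j differ and k and l differ, the entry (k, i) occurs exactly once in the product, so
    [flip (k, i)] maps the sum to its opposite. Otherwise each term is at most 1. *)
Lemma sum_prod4 (i j : 'I_q) (k l : 'I_p) :
  \sum_(tau : grid) aval (tau (k, i)) * aval (tau (k, j)) * (aval (tau (l, i)) * aval (tau (l, j)))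
  <= #|{: grid}|%:R * ((i == j)%:R + (k == l)%:R) :> R.
Proof.
case: (altP (i =P j)) => [_|ij].
  apply: (@le_trans _ _ (\sum_(tau : grid) 1)).
    apply: ler_sum => tau _.
    have := aval_sqr_le (tau (k, i)); have := aval_sqr_le (tau (k, j)).
    have := aval_sqr_le (tau (l, i)); have := aval_sqr_le (tau (l, j)).
    move: (aval (tau (k, i))) (aval (tau (k, j))) (aval (tau (l, i))) (aval (tau (l, j))).
    move=> a b c d d1 c1 b1 a1.
    have h1 : `|d| <= 1 by rewrite -(@ler_pXn2r _ 2)// ?nnegrE// expr1n real_normK ?num_real.
    have h2 : `|c| <= 1 by rewrite -(@ler_pXn2r _ 2)// ?nnegrE// expr1n real_normK ?num_real.
    have h3 : `|b| <= 1 by rewrite -(@ler_pXn2r _ 2)// ?nnegrE// expr1n real_normK ?num_real.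
    have h4 : `|a| <= 1 by rewrite -(@ler_pXn2r _ 2)// ?nnegrE// expr1n real_normK ?num_real.
    apply: (le_trans (ler_norm _)); rewrite !normrM.
    by apply: (mulr_ile1 (mulr_ge0 _ _) (mulr_ge0 _ _) (mulr_ile1 _ _ _ _) (mulr_ile1 _ _ _ _)).
  rewrite sumr_const mulrDr mulr1 lerDl mulr_ge0//.
case: (altP (k =P l)) => [<-|kl].
  rewrite add0r mulr1 -sumr_const; apply: ler_sum => tau _.
  rewrite -expr2 exprMn mulr_ile1 ?sqr_ge0 ?aval_sqr_le//.
rewrite addr0 mulr0.
set S := \sum_(tau : grid) _; suff : S = - S by lra.
rewrite {1}/S (reindex_inj (inv_inj (flipK (k, i)))) -sumrN; apply: eq_bigr => tau _.
have E x : x != (k, i) -> flip (k, i) tau x = tau x by rewrite ffunE => /negbTE ->.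
rewrite ffunE eqxx aval_rev !E ?xpair_eqE ?eqxx ?[j == i]eq_sym ?[l == k]eq_sym
  ?(negbTE ij) ?(negbTE kl)//.
by rewrite !mulNr.
Qed.

(** By [sum_prod4] the mean of |B^T B|^2 is at most (q p^2 + q^2 p) / q^2 = p^2 / q + p, and p <=
    q. *)
Lemma sum_fsq_gram :
  \sum_(tau : grid) fsq ((gmx tau)^T *m gmx tau) <= #|{: grid}|%:R * (2 * p%:R).
Proof.
have E tau : fsq ((gmx tau)^T *m gmx tau) = (q%:R ^+ 2)^-1 *
    \sum_i \sum_j \sum_k \sum_l
     aval (tau (k, i)) * aval (tau (k, j)) * (aval (tau (l, i)) * aval (tau (l, j))).
  rewrite /fsq mulr_sumr; apply: eq_bigr => i _; rewrite mulr_sumr; apply: eq_bigr => j _.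
  rewrite mxE expr2 mulr_suml mulr_sumr; apply: eq_bigr => k _.
  rewrite !mulr_sumr; apply: eq_bigr => l _; rewrite !mxE.
  have -> : q%:R ^+ 2 = Num.sqrt q%:R ^+ 4 :> R by rewrite -[4%N]/(2 * 2)%N exprM sq.
  by field; rewrite sqrtr_eq0 -ltNge.
under eq_bigr do rewrite E; rewrite -mulr_sumr ler_pdivrMl ?exprn_gt0//.
rewrite exchange_big /=.
under eq_bigr do rewrite exchange_big /=.
under eq_bigr do under eq_bigr do rewrite exchange_big /=.
under eq_bigr do under eq_bigr do under eq_bigr do rewrite exchange_big /=.
apply: (@le_trans _ _ (\sum_(i < q) \sum_(j < q) \sum_(k < p) \sum_(l < p)
    #|{: grid}|%:R * ((i == j)%:R + (k == l)%:R))).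
  by do 4 (apply: ler_sum => ? _); exact: sum_prod4.
have sum_eq m (i : 'I_m) : \sum_(j < m) (i == j)%:R = 1 :> R.
  by rewrite (bigD1 i)//= eqxx big1 ?addr0// => j; rewrite eq_sym => /negbTE ->.
have -> : \sum_(i < q) \sum_(j < q) \sum_(k < p) \sum_(l < p)
    #|{: grid}|%:R * ((i == j)%:R + (k == l)%:R) =
    #|{: grid}|%:R * (q%:R * p%:R ^+ 2 + q%:R ^+ 2 * p%:R) :> R.
  have el (c : R) (k : 'I_p) : \sum_(l < p) #|{: grid}|%:R * (c + (k == l)%:R)
      = #|{: grid}|%:R * (c * p%:R + 1).
    by rewrite -mulr_sumr big_split /= sumr_const card_ord sum_eq mulr_natr.
  have ek (c : R) : \sum_(k < p) \sum_(l < p) #|{: grid}|%:R * (c + (k == l)%:R)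
      = #|{: grid}|%:R * p%:R * (c * p%:R + 1).
    under eq_bigr do rewrite el.
    by rewrite sumr_const card_ord -[LHS]mulr_natr mulrAC.
  have ej (i : 'I_q) : \sum_(j < q) \sum_(k < p) \sum_(l < p)
      #|{: grid}|%:R * ((i == j)%:R + (k == l)%:R) = #|{: grid}|%:R * p%:R * (p%:R + q%:R) :> R.
    under eq_bigr do rewrite ek.
    by rewrite -mulr_sumr big_split /= -mulr_suml sum_eq mul1r sumr_const card_ord.
  under eq_bigr do rewrite ej.
  by rewrite sumr_const card_ord -[LHS]mulr_natr; ring.
rewrite [leRHS]mulrCA ler_wpM2l//.
have : 0 <= q%:R * p%:R * (q%:R - p%:R) :> R by rewrite !mulr_ge0// subr_ge0 ler_nat.
by lra.
Qed.

(** Markov's inequality: the threshold is four times the bound [2 * p%:R] on the mean. *)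
Lemma card_bad :
  (#|[pred tau : grid | (8 * p%:R < fsq ((gmx tau)^T *m gmx tau))%R]| * 4 <= #|{: grid}|)%N.
Proof.
set bad := [pred tau : grid | _].
have : (8 * p%:R) * #|bad|%:R <= #|{: grid}|%:R * (2 * p%:R) :> R.
  apply: le_trans sum_fsq_gram.
  rewrite (bigID (mem bad)) /= mulr_natr -sumr_const.
  rewrite -[X in X <= _]addr0 lerD//; last by apply: sumr_ge0 => tau _; exact: fsq_ge0.
  by apply: ler_sum => tau; rewrite inE => /ltW.
rewrite -(ler_nat R) natrM.
have : 0 < p%:R :> R by rewrite ltr0n.
by set x := _%:R; set y := _%:R; set z := _%:R; nra.
Qed.

Definition hamming (tau sigma : grid) : nat := #|[pred x | tau x != sigma x]|.

Lemma fsq_gmx_sub tau sigma :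
  (hamming tau sigma)%:R <= 64 ^+ 2 * q%:R * fsq (gmx tau - gmx sigma).
Proof.
rewrite /hamming -sum1_card natr_sum /fsq pair_bigA mulr_sumr big_mkcond /=.
apply: ler_sum => x _; rewrite inE; case: ifPn => [tx|_]; last first.
  by rewrite mulr_ge0 ?sqr_ge0// pmulr_rge0 ?ltW.
rewrite !mxE -!surjective_pairing.
move: (aval (tau x)) (aval (sigma x)) (aval_sub tx) => a b h.
rewrite -mulrBl expr_div_n sq.
rewrite (_ : _ * _ = 64 ^+ 2 * (a - b) ^+ 2); last by field; rewrite gt_eqF.
by rewrite -ler_pdivrMl ?exprn_gt0// mulr1.
Qed.

(** Exponential moment: the sum of 128^-hamming over the grid factors over the m = p q coordinates,
    with factors at most 2. On the ball each term is at least 2^-m because 128 = 2^7, so the ball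
    has at most 2^m 2^m elements. *)
Lemma card_hamming_ball (sigma : grid) :
  (#|[pred tau : grid | 7 * hamming tau sigma <= p * q]| <= 4 ^ (p * q))%N.
Proof.
set m := (p * q)%N; set ball := [pred tau : grid | _].
pose F (x : 'I_p * 'I_q) (t : 'I_128) : R := if t != sigma x then 128^-1 else 1.
have F0 x t : 0 <= F x t by rewrite /F; case: ifP.
have sumF x : \sum_t F x t <= 2.
  rewrite (bigD1 (sigma x))//= {1}/F eqxx /=.
  apply: (@le_trans _ _ (1 + \sum_(t : 'I_128) 128^-1)).
    rewrite lerD2l [leRHS](bigID (fun t => t != sigma x)) /=.
    rewrite -[X in X <= _]addr0; apply: lerD; last by apply: sumr_ge0.
    by apply: ler_sum => t ts; rewrite /F ts.
  by rewrite sumr_const card_ord -mulr_natr; lra.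
have prodF (tau : grid) : \prod_x F x (tau x) = 128 ^- (hamming tau sigma).
  by rewrite /F -big_mkcond /= prodr_const exprVn.
have total : \sum_(tau : grid) 128 ^- (hamming tau sigma) <= 2 ^+ m :> R.
  under eq_bigr do rewrite -prodF.
  rewrite -(bigA_distr_bigA F) /=.
  have -> : 2 ^+ m = \prod_(x : 'I_p * 'I_q) (2 : R).
    by rewrite prodr_const card_prod !card_ord.
  by apply: ler_prod => x _; rewrite sumF sumr_ge0.
have low : #|ball|%:R * 2 ^- m <= 2 ^+ m :> R.
  apply: le_trans total; rewrite mulr_natl -sumr_const [leRHS](bigID (mem ball)) /=.
  rewrite -[X in X <= _]addr0; apply: lerD; last first.
    by apply: sumr_ge0 => tau _; rewrite invr_ge0 exprn_ge0.
  apply: ler_sum => tau; rewrite inE => h7.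
  rewrite lef_pV2 ?posrE ?exprn_gt0//.
  have -> : 128 = 2 ^+ 7 :> R by ring.
  by rewrite -exprM ler_weXn2l// ler1n.
rewrite -(ler_nat R) natrX (_ : 4%:R = 2 * 2 :> R); last by ring.
by rewrite exprMn -ler_pdivrMr ?exprn_gt0.
Qed.

Lemma card_grid : #|{: grid}| = (128 ^ (p * q))%N.
Proof. by rewrite card_ffun card_prod !card_ord. Qed.

(** Passing through the truncations costs 3 (2 h^2 + rho + 2 h^2) p in squared norm; [fsq_gmx_sub]
    turns this into a Hamming distance, at the price of 64^2 q. *)
Lemma hamming_trunc (h rho : R) tau sigma :
  0 < h -> 21 * 64 ^+ 2 * (4 * h ^+ 2 + rho) <= 1 ->
  fsq ((gmx tau)^T *m gmx tau) <= 8 * p%:R ->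
  fsq ((gmx sigma)^T *m gmx sigma) <= 8 * p%:R ->
  fsq (trunc h (gmx tau) - trunc h (gmx sigma)) <= rho * p%:R ->
  (7 * hamming tau sigma <= p * q)%N.
Proof.
move=> h0 hr gt gs ts.
have := fsqD3_le (gmx tau - trunc h (gmx tau)) (trunc h (gmx tau) - trunc h (gmx sigma))
  (trunc h (gmx sigma) - gmx sigma).
rewrite !addrA !subrK => d3.
have bt := fsq_sub_trunc h0 (gmx tau); have bs := fsq_sub_trunc h0 (gmx sigma).
rewrite (fsqB (trunc h (gmx sigma))) in d3.
have h2 : 0 <= h ^+ 2 by rewrite sqr_ge0.
have bt' : h ^+ 2 / 4 * fsq ((gmx tau)^T *m gmx tau) <= h ^+ 2 / 4 * (8 * p%:R).
  by rewrite ler_wpM2l// mulr_ge0.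
have bs' : h ^+ 2 / 4 * fsq ((gmx sigma)^T *m gmx sigma) <= h ^+ 2 / 4 * (8 * p%:R).
  by rewrite ler_wpM2l// mulr_ge0.
have D : fsq (gmx tau - gmx sigma) <= 3 * (4 * h ^+ 2 + rho) * p%:R.
  move: d3 bt bs bt' bs' ts.
  move: (fsq (gmx tau - gmx sigma)) (fsq (gmx tau - _)) (fsq (gmx sigma - _)) => u v w.
  move: (fsq (trunc _ _ - _)) (h ^+ 2 / 4 * fsq _) (h ^+ 2 / 4 * fsq _) => x y z.
  by move=> *; lra.
have := fsq_gmx_sub tau sigma => H.
rewrite -(ler_nat R) !natrM.
have : 7 * (hamming tau sigma)%:R <= 7 * (64 ^+ 2 * q%:R * (3 * (4 * h ^+ 2 + rho) * p%:R)) :> R.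
  rewrite ler_wpM2l//; apply: (le_trans H); rewrite ler_wpM2l// mulr_ge0// ltW//.
move=> H7; apply: (le_trans H7).
rewrite (_ : 7 * _ = 21 * 64 ^+ 2 * (4 * h ^+ 2 + rho) * (p%:R * q%:R)); last by ring.
by rewrite ler_piMl// mulr_ge0.
Qed.

End hypercube.

(** * Kronecker embedding of one mode *)

Section mode.
Context {R : realType} (k : nat) (d : 'I_k -> nat) (a : 'I_k).
Implicit Types (u v w : mindex d) (A B : 'M[R]_(d a)).

Definition offeq u v := [forall b, (b != a) ==> (u b == v b)].

Definition upd u (t : 'I_(d a)) : mindex d := [ffun b => dfwith u a t b].

Lemma upd_at u t : upd u t a = t.
Proof. by rewrite ffunE dfwithin. Qed.

Lemma upd_off u t b : b != a -> upd u t b = u b.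
Proof. by move=> ba; rewrite ffunE dfwithout// eq_sym. Qed.

Lemma offeqC u v : offeq u v = offeq v u.
Proof. by apply: eq_forallb => b; rewrite [u b == _]eq_sym. Qed.

Lemma offeq_updl u t v : offeq (upd u t) v = offeq u v.
Proof.
apply: eq_forallb => b; case: eqVneq => //= ba; by rewrite upd_off.
Qed.

Lemma offeq_refl u : offeq u u.
Proof. by apply/forallP => b; rewrite eqxx implybT. Qed.

Lemma eq_offeq u v : (u == v) = (u a == v a) && offeq u v.
Proof.
apply/eqP/andP => [->|[/eqP e /forallP uv]]; first by rewrite eqxx offeq_refl.
apply/ffunP => b; case: (eqVneq b a) => [->//|ba].
by have := uv b; rewrite ba => /eqP.
Qed.

(** The multi-indices that agree with [u] off mode [a] are the [upd u t], one for each [t]; this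
    reduces sums over multi-indices to sums over one mode. *)
Lemma sum_offeq u (F : mindex d -> R) :
  \sum_v F v * (offeq u v)%:R = \sum_t F (upd u t).
Proof.
under eq_bigr do rewrite mulr_natr mulrb.
rewrite -big_mkcond /= (reindex_onto (upd u) (fun v => v a)).
  apply: eq_bigl => t; rewrite upd_at eqxx andbT offeqC offeq_updl offeq_refl//.
move=> v uv; apply/eqP; rewrite eq_offeq upd_at eqxx offeq_updl//.
Qed.

(** Double counting of the pairs of multi-indices that agree off mode [a]; keeping [d a] on the left
    avoids a quotient of cardinals. *)
Lemma sum_mode (g : 'I_(d a) -> R) :
  (d a)%:R * \sum_(u : mindex d) g (u a) = (#|mindex d|)%:R * \sum_t g t.
Proof.
transitivity (\sum_(u : mindex d) \sum_(v : mindex d) g (v a) * (offeq u v)%:R); last first.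
  under eq_bigr => u _ do rewrite sum_offeq.
  under eq_bigr do under eq_bigr do rewrite upd_at.
  by rewrite sumr_const mulr_natl.
rewrite exchange_big mulr_sumr; apply: eq_bigr => v _.
under eq_bigr do rewrite offeqC.
rewrite (sum_offeq v (fun=> g (v a))) sumr_const card_ord mulr_natl//.
Qed.

Lemma sum_enum_val (F : mindex d -> R) :
  \sum_(i < #|mindex d|) F (enum_val i) = \sum_u F u.
Proof.
rewrite [RHS](reindex (@enum_val _ (mindex d)))//.
by apply: onW_bij; exact: enum_val_bij.
Qed.

Notation K := (@mode_precision R k d a).

Lemma modeE A i j : K A i j =
  A ((enum_val i : mindex d) a) ((enum_val j : mindex d) a) *
  (offeq (enum_val i) (enum_val j))%:R.
Proof.
rewrite mxE (bigD1 a)//= dfwithin; congr (_ * _).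
set u := enum_val i; set v := enum_val j.
rewrite (eq_bigr (fun b => (u b == v b)%:R)); last first.
  by move=> b ba; rewrite dfwithout ?mxE// eq_sym.
case: (boolP (offeq u v)) => [/forallP uv|].
  by rewrite big1// => b ba; have := uv b; rewrite ba => /eqP ->; rewrite eqxx.
rewrite negb_forall => /existsP[b]; rewrite negb_imply => /andP[ba ub].
by rewrite (bigD1 b)//= (negbTE ub) mul0r.
Qed.

Lemma mode1 : K 1%:M = 1%:M.
Proof.
apply/matrixP => i j; rewrite modeE !mxE -natrM mulnb -eq_offeq.
by rewrite (inj_eq enum_val_inj).
Qed.

Lemma modeM A B : K (A *m B) = K A *m K B.
Proof.
apply/matrixP => i j; rewrite modeE !mxE.
set u := enum_val i; set w := enum_val j.
under [RHS]eq_bigr do rewrite !modeE -/u -/w.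
rewrite (sum_enum_val (fun v : mindex d => A (u a) (v a) * (offeq u v)%:R
  * (B (v a) (w a) * (offeq v w)%:R))).
under [RHS]eq_bigr do rewrite mulrAC.
rewrite (sum_offeq u (fun v : mindex d => A (u a) (v a) * (B (v a) (w a) * (offeq v w)%:R))).
rewrite mulr_suml; apply: eq_bigr => t _.
by rewrite upd_at offeq_updl mulrA.
Qed.

Lemma modeD A B : K (A + B) = K A + K B.
Proof. by apply/matrixP => i j; rewrite mxDE !modeE mxDE mulrDl. Qed.

Lemma modeZ c A : K (c *: A) = c *: K A.
Proof. by apply/matrixP => i j; rewrite mxZE !modeE mxZE mulrA. Qed.

Lemma modeB A B : K (A - B) = K A - K B.
Proof. by rewrite modeD -scaleN1r modeZ scaleN1r. Qed.

Lemma modeT A : K A^T = (K A)^T.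
Proof. by apply/matrixP => i j; rewrite [RHS]mxE !modeE mxE offeqC. Qed.

Lemma fsq_mode A : (d a)%:R * fsq (K A) = (#|mindex d|)%:R * fsq A.
Proof.
rewrite -(sum_mode (fun s => \sum_t A s t ^+ 2)); congr (_ * _).
rewrite -(sum_enum_val (fun u : mindex d => \sum_t A (u a) t ^+ 2)) /fsq; apply: eq_bigr => i _.
set u := enum_val i.
under eq_bigr do rewrite modeE -/u exprMn -natrX.
rewrite (sum_enum_val (fun v : mindex d => A (u a) (v a) ^+ 2 * ((offeq u v) ^ 2)%:R)).
transitivity (\sum_(v : mindex d) A (u a) (v a) ^+ 2 * (offeq u v)%:R).
  by apply: eq_bigr => v _; case: offeq.
by rewrite sum_offeq; apply: eq_bigr => t _; rewrite upd_at.
Qed.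

Lemma mode_unit A : A \in unitmx -> K A \in unitmx.
Proof.
move=> uA; have /mulmx1_unit[] // : K A *m K (invmx A) = 1%:M.
by rewrite -modeM mulmxV// mode1.
Qed.

Lemma mode_inv A : A \in unitmx -> K (invmx A) = invmx (K A).
Proof.
move=> uA; rewrite -[RHS]mulmx1 -mode1 -(mulmxV uA) modeM mulKmx//.
exact: mode_unit.
Qed.

Lemma mode_res A : posdef A -> K (res A) = res (K A).
Proof.
move=> pA; rewrite /res mode_inv ?modeD ?mode1//; exact: unitmx_1D.
Qed.

Lemma psd_factor n (M : 'M[R]_n) : M^T = M ->
  (forall v : 'cV[R]_n, 0 <= (v^T *m M *m v) 0 0) -> exists W : 'M[R]_n, M = W^T *m W.
Proof.
move=> MT qM; have [Q [l [QQ ME]]] := spectral_sym MT.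
have l0 i : 0 <= l 0 i by have [_ <-] := spec_quad l i QQ; rewrite -ME.
exists (diag_mx (map_mx Num.sqrt l) *m Q).
rewrite trmx_mul tr_diag_mx -mulmxA (mulmxA (diag_mx _)) mulmx_diag mulmxA ME.
congr (_ *m diag_mx _ *m _); apply/rowP => i.
by rewrite !mxE -expr2 sqr_sqrtr.
Qed.

Lemma mode_psd A : A^T = A -> (forall v : 'cV[R]_(d a), 0 <= (v^T *m A *m v) 0 0) ->
  forall v : 'cV[R]_#|mindex d|, 0 <= (v^T *m K A *m v) 0 0.
Proof.
move=> AT qA v; have [W ->] := psd_factor AT qA.
by rewrite modeM modeT -mulmxA -mulmxA mulmxA -trmx_mul -fsq_cV fsq_ge0.
Qed.

Lemma mode_ge A c : A^T = A ->
  (forall v : 'cV[R]_(d a), c * fsq v <= (v^T *m A *m v) 0 0) ->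
  forall v : 'cV[R]_#|mindex d|, c * fsq v <= (v^T *m K A *m v) 0 0.
Proof.
move=> AT qA v; have := @mode_psd (A - c *: 1%:M).
rewrite linearB /= linearZ /= trmx1 AT => /(_ erefl) H.
have := H _ v; rewrite modeB modeZ mode1 mulmxBr mulmxBl mxDE mxNE.
rewrite -scalemxAr mulmx1 -scalemxAl mxZE -fsq_cV subr_ge0; apply.
move=> w; rewrite mulmxBr mulmxBl mxDE mxNE.
by rewrite -scalemxAr mulmx1 -scalemxAl mxZE -fsq_cV subr_ge0.
Qed.

Lemma mode_posdef A : posdef A -> posdef (K A).
Proof.
move=> pA; have [ST SS uS] := sqrtmxP pA; set S := sqrtmx A in ST SS uS.
split=> [|v v0]; first by rewrite -modeT (proj1 pA).
have -> : (v^T *m K A *m v) 0 0 = fsq (K S *m v).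
  by rewrite -SS modeM -{1}ST modeT fsq_cV trmx_mul !mulmxA.
apply: fsq_gt0; apply: contra_neq v0 => Sv0.
by rewrite -(mulKmx (mode_unit uS) v) Sv0 mulmx0.
Qed.

Lemma posdef1 n : posdef (1%:M : 'M[R]_n).
Proof. by split=> [|v v0]; rewrite ?trmx1// mulmx1 -fsq_cV fsq_gt0. Qed.

Lemma mode_in_class A : posdef A -> kron_class R k d (K A).
Proof.
move=> pA; exists (dfwith (fun b => 1%:M) a A) => //= b.
by case: dfwithP => [|b' _]; [exact: pA|exact: posdef1].
Qed.

End mode.

(** * Gaussian laws under linear maps *)

Section affine.
Context {R : realType}.
Notation mu := (@lebesgue_measure R).
Variables (a b : R).
Hypothesis a0 : a != 0.
Let phi : measurableTypeR R -> measurableTypeR R := fun x => a * x + b.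
Let mphi : measurable_fun setT phi.
Proof. by apply: measurable_funD => //; apply: measurable_funM. Qed.
Let na : {nonneg R} := NngNum (normr_ge0 a).
Let nu : {measure set (measurableTypeR R) -> \bar R}.
Proof. by refine (mscale na (pushforward mu phi)); exact: mphi. Defined.

(** Uniqueness of Lebesgue measure: [nu], the pushforward scaled by |a|, gives half-open intervals
    their length. *)
Lemma lebesgue_measure_affine A : measurable A -> mu A = nu A.
Proof.
apply: lebesgue_measure_unique => _ [[u v] _ <-] /=.
rewrite /nu /= /mscale /= /pushforward /=.
(* A negative slope turns the interval around, so that it becomes closed on the left. *)
have -> : phi @^-1` `]u, v] = 
    if 0 < a then `](u-b)/a, (v-b)/a]%classic else `[(v-b)/a, (u-b)/a[%classic.
  case: ltP => aa; apply/seteqP; split => x /=; rewrite !in_itv /= /phi.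
  - by rewrite ltr_pdivrMr// ler_pdivlMr// ltrBlDr lerBrDr mulrC.
  - by rewrite ltr_pdivrMr// ler_pdivlMr// ltrBlDr lerBrDr mulrC.
  - have {}aa : a < 0 by rewrite lt_neqAle a0.
    by rewrite ler_ndivrMr// ltr_ndivlMr// ltrBlDr lerBrDr mulrC andbC.
  - have {}aa : a < 0 by rewrite lt_neqAle a0.
    by rewrite ler_ndivrMr// ltr_ndivlMr// ltrBlDr lerBrDr mulrC andbC.
case: ltP => aa.
  rewrite !lebesgue_measure_itv /= !lte_fin ltr_pM2r ?invr_gt0// ltrD2r.
  case: ifPn => _; last by rewrite mule0.
  rewrite -!EFinD -EFinM gtr0_norm//; congr EFin; field; exact: a0.
have {}aa : a < 0 by rewrite lt_neqAle a0.
rewrite !lebesgue_measure_itv /= !lte_fin ltr_nM2r ?invr_lt0// ltrD2r.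
case: ifPn => _; last by rewrite mule0.
rewrite -!EFinD -EFinM ltr0_norm//; congr EFin; field; exact: a0.
Qed.

Lemma ge0_integral_affine (h : R -> \bar R) : measurable_fun setT h ->
  (forall x, 0 <= h x)%E ->
  (`|a|%:E * \int[mu]_x h (a * x + b)%R = \int[mu]_x h x)%E.
Proof.
move=> mh h0.
transitivity (\int[nu]_x h x)%E; last first.
  by apply: eq_measure_integral => A mA _; apply: (esym (lebesgue_measure_affine mA)).
by rewrite ge0_integral_mscale// ge0_integral_pushforward.
Qed.
End affine.

Section density.
Context d (T : measurableType d) (R : realType).
Variables (mu : {sigma_finite_measure set T -> \bar R})
  (nu : probability T R) (g : T -> R).
Hypothesis mg : measurable_fun setT g.
Hypothesis g0 : forall x, 0 <= g x.
Hypothesis nuE : forall A, measurable A -> nu A = (\int[mu]_(x in A) (g x)%:E)%E.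

(** [g] and the Radon-Nikodym derivative have the same integral over every measurable set, hence
    agree almost everywhere. *)
Lemma ge0_integral_density (f : T -> \bar R) : measurable_fun setT f ->
  (forall x, 0 <= f x)%E ->
  (\int[nu]_x f x = \int[mu]_x (f x * (g x)%:E))%E.
Proof.
move=> mf f0.
have dom : nu `<< mu.
  apply/null_content_dominatesP => A mA A0; rewrite nuE//.
  by apply: null_set_integral => //; apply/measurable_EFinP; exact: measurable_funTS.
rewrite -(Radon_Nikodym_SigmaFinite.change_of_variables dom)//.
have RNi := Radon_Nikodym_SigmaFinite.f_integrable dom.
apply: ae_eq_integral => //.
- by apply: emeasurable_funM => //; exact: (measurable_int mu).
- by apply: emeasurable_funM => //; exact/measurable_EFinP.
apply: ae_eqe_mul2l.
apply: integral_ae_eq => //; first exact/measurable_EFinP.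
by move=> E _ mE; rewrite -nuE// -Radon_Nikodym_SigmaFinite.f_integral.
Qed.
End density.

Section std_normal.
Context {R : realType}.
Notation mu := (@lebesgue_measure R).

(** The weight cancels the Gaussian density up to its constant, so that affine changes of variable
    pass from Lebesgue measure to [std_normal]. *)
Lemma ge0_integral_std_normal (f : R -> \bar R) : measurable_fun setT f ->
  (forall x, 0 <= f x)%E ->
  (\int[std_normal]_x (f x * (expR (x ^+ 2 / 2))%:E) = (normal_peak 1)%:E * \int[mu]_x f x)%E.
Proof.
move=> mf f0.
have me : measurable_fun setT (fun x : R => (expR (x ^+ 2 / 2))%:E).
  apply/measurable_EFinP; apply: measurableT_comp => //.
  by apply: measurable_funM => //; exact: measurable_funX.
rewrite ge0_integral_distribution//; last 2 first.
- by apply: emeasurable_funM.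
- by move=> y; rewrite mule_ge0// lee_fin expR_ge0.
rewrite (@ge0_integral_density _ _ _ mu _ (normal_pdf 0 1))//; last 3 first.
- exact: measurable_normal_pdf.
- exact: (emeasurable_funM mf me).
- by move=> y; rewrite mule_ge0// lee_fin expR_ge0.
rewrite -ge0_integralZl//; last by rewrite lee_fin normal_peak_ge0.
apply: eq_integral => x _ /=; rewrite /toR /= normal_pdfE ?oner_eq0//.
rewrite -muleA -EFinM muleC; congr (_ * _)%E; congr EFin.
rewrite /normal_fun subr0 expr1n mulrCA -expRD.
suff -> : x ^+ 2 / 2 + - x ^+ 2 / (1 *+ 2) = 0 by rewrite expR0 mulr1.
by rewrite mulNr subrr.
Qed.

Lemma std_normal_affine (h : R -> \bar R) (a b : R) : a != 0 ->
  measurable_fun setT h -> (forall x, 0 <= h x)%E ->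
  (`|a|%:E * \int[std_normal]_x (h (a * x + b)%R * (expR (x ^+ 2 / 2))%:E)
   = \int[std_normal]_x (h x * (expR (x ^+ 2 / 2))%:E))%E.
Proof.
move=> a0 mh h0; have mphi : measurable_fun setT (fun x : R => a * x + b).
  by apply: measurable_funD => //; apply: measurable_funM.
rewrite !ge0_integral_std_normal//; last exact: (measurableT_comp mh mphi).
by rewrite muleCA ge0_integral_affine.
Qed.
End std_normal.

Section iid_integral.
Context dT (T : measurableType dT) (R : realType) (P : probability T R).

Lemma measurable_tcons n : measurable_fun setT (@tcons _ T n).
Proof. exact: measurable_cons. Qed.

Lemma ge0_integral_iidS n (f : n.+1.-tuple T -> \bar R) :
  measurable_fun setT f -> (forall z, 0 <= f z)%E ->
  (\int[iid P n.+1]_z f z = \int[P]_x \int[iid P n]_y f (tcons (x, y)))%E.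
Proof.
move=> mf f0; rewrite [LHS]ge0_integral_distribution//.
rewrite [LHS](@fubini_tonelli1 _ _ _ _ _ P (iid P n) (f \o @tcons _ T n))//; last first.
  by move=> z; exact: f0.
by apply: measurableT_comp => //; exact: measurable_tcons.
Qed.

Lemma ge0_integral_iidSC n (f : n.+1.-tuple T -> \bar R) :
  measurable_fun setT f -> (forall z, 0 <= f z)%E ->
  (\int[iid P n.+1]_z f z = \int[iid P n]_y \int[P]_x f (tcons (x, y)))%E.
Proof.
move=> mf f0; rewrite ge0_integral_iidS//.
rewrite [LHS](@fubini_tonelli _ _ _ _ _ P (iid P n) (f \o @tcons _ T n))//; last first.
  by move=> z; exact: f0.
by apply: measurableT_comp => //; exact: measurable_tcons.
Qed.

Lemma integral_iid0 (f : 0.-tuple T -> \bar R) :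
  measurable_fun setT f -> (\int[iid P 0]_z f z = f [tuple])%E.
Proof. by move=> mf; rewrite [LHS]integral_dirac// diracT mul1e. Qed.

Lemma tuple_tcons n (z : n.+1.-tuple T) : exists x y, z = tcons (x, y).
Proof.
by exists (thead z), [tuple of behead z]; rewrite [LHS]tuple_eta.
Qed.

Lemma tnth_tcons0 n x (y : n.-tuple T) : tnth (tcons (x, y)) ord0 = x.
Proof. by []. Qed.

Lemma tnth_tconsS n x (y : n.-tuple T) i :
  tnth (tcons (x, y)) (lift ord0 i) = tnth y i.
Proof. exact: tnthS. Qed.

End iid_integral.

Section gaussian_change.
Context {R : realType}.

Definition tsq p (z : p.-tuple R) : R := \sum_j tnth z j ^+ 2.

Lemma measurable_tsq p : measurable_fun setT (@tsq p).
Proof.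
apply: measurable_sum => j; apply: measurable_funX.
exact: measurable_tnth.
Qed.

Lemma measurable_mulmx_tuple p (S : 'M[R]_p) :
  measurable_fun setT (mulmx_tuple S).
Proof. exact: measurable_funPT. Qed.

Lemma tsq_tcons p x (y : p.-tuple R) : tsq (tcons (x, y)) = x ^+ 2 + tsq y.
Proof.
rewrite /tsq big_ord_recl tnth_tcons0; congr (_ + _).
by apply: eq_bigr => i _; rewrite tnth_tconsS.
Qed.

Definition gw p (z : p.-tuple R) : \bar R := (expR (tsq z / 2))%:E.

Lemma measurable_gw p : measurable_fun setT (@gw p).
Proof.
apply/measurable_EFinP; apply: measurableT_comp => //.
by apply: measurable_funM => //; exact: measurable_tsq.
Qed.

Lemma gw_ge0 p (z : p.-tuple R) : (0 <= gw z)%E.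
Proof. by rewrite lee_fin expR_ge0. Qed.

Lemma gw_tcons p x (y : p.-tuple R) :
  gw (tcons (x, y)) = ((expR (x ^+ 2 / 2))%:E * gw y)%E.
Proof. by rewrite /gw tsq_tcons mulrDl expRD EFinM. Qed.

(* [gw] times the standard Gaussian law is, up to a constant, Lebesgue measure on R^p. *)
Definition gpres p (phi : p.-tuple R -> p.-tuple R) (c : R) :=
  forall f : p.-tuple R -> \bar R, measurable_fun setT f ->
  (forall z, 0 <= f z)%E ->
  (c%:E * \int[iid std_normal p]_z (f (phi z) * gw z)
     = \int[iid std_normal p]_z (f z * gw z))%E.

Lemma gpres_comp p (phi psi : p.-tuple R -> p.-tuple R) a b :
  measurable_fun setT phi -> gpres phi a -> gpres psi b ->
  gpres (phi \o psi) (a * b).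
Proof.
move=> mphi gphi gpsi f mf f0.
rewrite -(gphi f mf f0) -(gpsi (fun z => f (phi z)))//; last exact: (measurableT_comp mf mphi).
by rewrite EFinM muleA.
Qed.

(** For fixed first coordinate the tail is integrated with factor [c]; the first coordinate then
    undergoes an affine change of slope [a]. *)
Lemma gpres_fiber p (phi : p.+1.-tuple R -> p.+1.-tuple R)
    (psi : R -> p.-tuple R -> p.-tuple R) (a b c : R) :
  a != 0 -> 0 <= c -> measurable_fun setT phi ->
  (forall x y, phi (tcons (x, y)) = tcons (a * x + b, psi x y)) ->
  (forall x, gpres (psi x) c) -> gpres phi (c * `|a|).
Proof.
move=> a0 c0 mphi phiE gpsi f mf f0.
have mfphi : measurable_fun setT (fun z => f (phi z)) by exact: (measurableT_comp mf mphi).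
have mg := @measurable_gw p.+1.
have mgp := @measurable_gw p.
have mx x : measurable_fun setT (fun y : p.-tuple R => tcons (x, y)).
  by apply: (@measurable_cons _ _ _ _ (cst x) _ id).
have mfx x : measurable_fun setT (fun y : p.-tuple R => f (tcons (x, y))).
  exact: (measurableT_comp mf (mx x)).
have hge0 x : (0 <= \int[iid std_normal p]_y (f (tcons (x, y)) * gw y))%E.
  by apply: integral_ge0 => y _; rewrite mule_ge0// gw_ge0.
have mh : measurable_fun setT
    (fun x => \int[iid std_normal p]_y (f (tcons (x, y)) * gw y))%E.
  have := @measurable_fun_fubini_tonelli_F _ _ R (p.-tuple R) R (iid std_normal p)
    (fun xy => f (tcons xy) * gw xy.2)%E.
  apply => [|x]; last by rewrite mule_ge0// gw_ge0.
  apply: emeasurable_funM; last exact: (measurableT_comp mgp measurable_snd).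
  exact: (@measurableT_comp _ _ _ _ _ _ f setT (@tcons _ R p) mf (@measurable_tcons _ R p)).
have me : measurable_fun setT (fun x : R => (expR (x ^+ 2 / 2))%:E).
  apply/measurable_EFinP; apply: measurableT_comp => //.
  by apply: measurable_funM => //; exact: measurable_funX.
rewrite !ge0_integral_iidS; last 4 first.
- exact: emeasurable_funM.
- by move=> z; rewrite mule_ge0// gw_ge0.
- exact: emeasurable_funM.
- by move=> z; rewrite mule_ge0// gw_ge0.
transitivity (\int[std_normal]_x
    ((\int[iid std_normal p]_y (f (tcons (x, y)) * gw y))
      * (expR (x ^+ 2 / 2))%:E))%E; last first.
  apply: eq_integral => x _; rewrite -[LHS]ge0_integralZr//.
  - by apply: eq_integral => y _; rewrite gw_tcons -muleA (muleC (gw y)).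
  - exact: emeasurable_funM.
  - by move=> y _; rewrite mule_ge0// gw_ge0.
pose h x := (\int[iid std_normal p]_y (f (tcons (x, y)) * gw y))%E.
rewrite -(std_normal_affine b a0 (h := h))//.
rewrite mulrC EFinM -muleA; congr (_ * _)%E.
have mi : measurable_fun setT
    (fun x => \int[iid std_normal p]_y (f (phi (tcons (x, y))) * gw (tcons (x, y))))%E.
  have := @measurable_fun_fubini_tonelli_F _ _ R (p.-tuple R) R (iid std_normal p)
    (fun xy => f (phi (tcons xy)) * gw (tcons xy))%E.
  apply => [|x]; last by rewrite mule_ge0// gw_ge0.
  apply: emeasurable_funM.
  - exact: (@measurableT_comp _ _ _ _ _ _ (fun z => f (phi z)) setT (@tcons _ R p)
      mfphi (@measurable_tcons _ R p)).
  - exact: (@measurableT_comp _ _ _ _ _ _ (@gw p.+1) setT (@tcons _ R p)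
      mg (@measurable_tcons _ R p)).
have i0 x : (0 <= \int[iid std_normal p]_y (f (phi (tcons (x, y))) * gw (tcons (x, y))))%E.
  by apply: integral_ge0 => y _; rewrite mule_ge0// gw_ge0.
have c0E : (0 <= c%:E)%E by rewrite lee_fin.
rewrite -[LHS](ge0_integralZl std_normal measurableT mi (fun x _ => i0 x) c0E).
apply: eq_integral => x _.
rewrite /h -(gpsi x (fun y => f (tcons (a * x + b, y))))//.
rewrite -muleA; congr (_ * _)%E.
have mfpsi : measurable_fun setT (fun y => f (tcons (a * x + b, psi x y))).
  under eq_fun do rewrite -phiE.
  exact: (@measurableT_comp _ _ _ _ _ _ (fun z => f (phi z)) setT
    (fun y => tcons (x, y)) mfphi (mx x)).
rewrite -[RHS]ge0_integralZr//.
- by apply: eq_integral => y _; rewrite phiE gw_tcons -muleA (muleC (gw y)).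
- exact: emeasurable_funM.
- by move=> y _; rewrite mule_ge0// gw_ge0.
Qed.

(** With the integrals in the other order, the map is a translation of the first coordinate for each
    fixed tail. *)
Lemma gpres_shear p (phi : p.+1.-tuple R -> p.+1.-tuple R) (u : p.-tuple R -> R) :
  measurable_fun setT phi ->
  (forall x y, phi (tcons (x, y)) = tcons (x + u y, y)) -> gpres phi 1.
Proof.
move=> mphi phiE f mf f0; rewrite mul1e.
have mfphi : measurable_fun setT (fun z => f (phi z)) by exact: (measurableT_comp mf mphi).
have mg := @measurable_gw p.+1.
have me : measurable_fun setT (fun x : R => (expR (x ^+ 2 / 2))%:E).
  apply/measurable_EFinP; apply: measurableT_comp => //.
  by apply: measurable_funM => //; exact: measurable_funX.
have my (y : p.-tuple R) : measurable_fun setT (fun x : R => tcons (x, y)).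
  by apply: (@measurable_cons _ _ _ _ id _ (cst y)).
have mfy y : measurable_fun setT (fun x => f (tcons (x, y))).
  exact: (@measurableT_comp _ _ _ _ _ _ f setT (fun x => tcons (x, y)) mf (my y)).
rewrite !ge0_integral_iidSC; last 4 first.
- exact: emeasurable_funM.
- by move=> z; rewrite mule_ge0// gw_ge0.
- exact: emeasurable_funM.
- by move=> z; rewrite mule_ge0// gw_ge0.
apply: eq_integral => y _.
transitivity ((\int[std_normal]_x
    (f (tcons (x + u y, y)%R) * (expR (x ^+ 2 / 2))%:E)) * gw y)%E.
  rewrite -[RHS]ge0_integralZr//.
  - by apply: eq_integral => x _; rewrite phiE gw_tcons muleA.
  - apply: emeasurable_funM => //; under eq_fun do rewrite -phiE.
    exact: (@measurableT_comp _ _ _ _ _ _ (fun z => f (phi z)) setT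
      (fun x => tcons (x, y)) mfphi (my y)).
  - by move=> x _; rewrite mule_ge0// lee_fin expR_ge0.
  - exact: gw_ge0.
transitivity ((\int[std_normal]_x
    (f (tcons (x, y)) * (expR (x ^+ 2 / 2))%:E)) * gw y)%E; last first.
  rewrite -[LHS]ge0_integralZr//.
  - by apply: eq_integral => x _; rewrite gw_tcons muleA.
  - by apply: emeasurable_funM.
  - by move=> x _; rewrite mule_ge0// lee_fin expR_ge0.
  - exact: gw_ge0.
congr (_ * _)%E.
have := std_normal_affine (u y) (oner_neq0 R) (mfy y) (fun x => f0 _).
by rewrite normr1 mul1e => <-; apply: eq_integral => x _; rewrite mul1r.
Qed.

Definition tadd p (w z : p.-tuple R) : p.-tuple R :=
  [tuple tnth w i + tnth z i | i < p].

Lemma measurable_tadd p (w : p.-tuple R) : measurable_fun setT (tadd w).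
Proof.
apply/measurable_fun_tnthP => i.
rewrite [X in measurable_fun _ X](_ : _ = fun z : p.-tuple R => tnth w i + tnth z i).
  by apply: measurable_funD => //; exact: measurable_tnth.
by apply/funext => z /=; rewrite tnth_mktuple.
Qed.

Lemma tadd_tcons p w0 (w : p.-tuple R) x y :
  tadd (tcons (w0, w)) (tcons (x, y)) = tcons (1 * x + w0, tadd w y).
Proof.
apply: eq_from_tnth => i; rewrite tnth_mktuple.
case: (unliftP ord0 i) => [j ->|->]; last by rewrite !tnth_tcons0 mul1r addrC.
by rewrite !tnth_tconsS tnth_mktuple.
Qed.

Lemma gpres_tadd p (w : p.-tuple R) : gpres (tadd w) 1.
Proof.
elim: p w => [|p IH] w.
  move=> f mf f0; rewrite mul1e; apply: eq_integral => z _.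
  by rewrite (tuple0 (tadd w z)) (tuple0 z).
have [w0 [w' ->]] := tuple_tcons w.
have := @gpres_fiber p (tadd (tcons (w0, w'))) (fun _ => tadd w') 1 w0 1.
rewrite normr1 mulr1; apply => //; first exact: measurable_tadd.
exact: tadd_tcons.
Qed.

Lemma mulmx_tupleM p (S T : 'M[R]_p) (z : p.-tuple R) :
  mulmx_tuple (S *m T) z = mulmx_tuple S (mulmx_tuple T z).
Proof.
apply: eq_from_tnth => i; rewrite !tnth_mktuple.
under [RHS]eq_bigr do rewrite tnth_mktuple mulr_sumr.
rewrite exchange_big; apply: eq_bigr => j _; rewrite mxE mulr_suml.
by apply: eq_bigr => k _; rewrite mulrA.
Qed.

Lemma mulmx_tuple_block p a (u : 'rV[R]_p) (v : 'cV[R]_p) (S : 'M[R]_p) x y :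
  mulmx_tuple (block_mx a%:M u v S : 'M[R]_(1 + p)) (tcons (x, y)) =
  tcons (a * x + \sum_j u 0 j * tnth y j,
         tadd [tuple v i 0 * x | i < p] (mulmx_tuple S y)).
Proof.
apply: eq_from_tnth => i; rewrite tnth_mktuple big_ord_recl.
have E0 : ord0 = lshift p (ord0 : 'I_1) by apply: val_inj.
have ES j : lift ord0 j = rshift 1 j by apply: val_inj.
under eq_bigr => j _ do rewrite tnth_tconsS ES.
case: (unliftP ord0 i) => [j ->|->]; rewrite ?tnth_tconsS !tnth_tcons0 ?ES E0.
  rewrite !tnth_mktuple. rewrite block_mxEdl; congr (_ + _).
  by apply: eq_bigr => k _; rewrite block_mxEdr.
rewrite block_mxEul mxE mulr1n; congr (_ + _).
by apply: eq_bigr => k _; rewrite block_mxEur.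
Qed.

Lemma gpresM p (S T : 'M[R]_p) a b :
  gpres (mulmx_tuple S) a -> gpres (mulmx_tuple T) b ->
  gpres (mulmx_tuple (S *m T)) (a * b).
Proof.
move=> gS gT; rewrite (_ : mulmx_tuple _ = mulmx_tuple S \o mulmx_tuple T).
  exact: gpres_comp (measurable_mulmx_tuple S) gS gT.
by apply/funext => z /=; rewrite mulmx_tupleM.
Qed.

Lemma tadd0 p (y : p.-tuple R) x : tadd [tuple (0 : 'cV[R]_p) i 0 * x | i < p] y = y.
Proof. by apply: eq_from_tnth => i; rewrite !tnth_mktuple mxE mul0r add0r. Qed.

Lemma mulmx_tuple1 p (z : p.-tuple R) : mulmx_tuple 1%:M z = z.
Proof.
apply: eq_from_tnth => i; rewrite !tnth_mktuple (bigD1 i)//= mxE eqxx mul1r.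
by rewrite big1 ?addr0// => j ji; rewrite mxE eq_sym (negbTE ji) mul0r.
Qed.

Lemma gpres_upper p (u : 'rV[R]_p) :
  gpres (mulmx_tuple (block_mx 1%:M u 0 1%:M : 'M[R]_(1 + p))) 1.
Proof.
apply: (@gpres_shear p _ (fun y => \sum_j u 0 j * tnth y j)).
  exact: measurable_mulmx_tuple.
by move=> x y; rewrite mulmx_tuple_block mul1r mulmx_tuple1 tadd0.
Qed.

Lemma gpres_lower p (v : 'cV[R]_p) :
  gpres (mulmx_tuple (block_mx 1%:M 0 v 1%:M : 'M[R]_(1 + p))) 1.
Proof.
have := @gpres_fiber p (mulmx_tuple (block_mx 1%:M 0 v 1%:M : 'M[R]_(1 + p)))
  (fun x => tadd [tuple v i 0 * x | i < p]) 1 0 1.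
rewrite normr1 mulr1; apply => //.
- move=> x y; rewrite mulmx_tuple_block mulmx_tuple1 big1// => j _.
  by rewrite mxE mul0r.
- by move=> x; exact: gpres_tadd.
Qed.

(** Gaussian elimination by induction on the size: with a nonzero pivot the matrix is lower
    unitriangular, times block diagonal, times upper unitriangular. A zero pivot is first removed by
    adding another row to the first. *)
Lemma gpres_unitmx p (S : 'M[R]_p) : S \in unitmx ->
  gpres (mulmx_tuple S) `|\det S|.
Proof.
elim: p S => [|p IH] S uS.
  move=> f mf f0; rewrite det_mx00 normr1 mul1e; apply: eq_integral => z _.
  by rewrite (tuple0 (mulmx_tuple S z)) (tuple0 z).
pose S' : 'M[R]_(1 + p) := S.
have main (M : 'M[R]_(1 + p)) : M \in unitmx -> M 0 0 != 0 ->
    gpres (mulmx_tuple M) `|\det M|.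
  move=> uM a0.
  pose a := M 0 0; pose u := ursubmx M; pose v := dlsubmx M; pose T := drsubmx M.
  have ME : M = block_mx a%:M u v T.
    rewrite -[LHS]submxK; congr block_mx.
    by apply/matrixP => i j; rewrite !mxE !ord1 eqxx mulr1n /a; congr (M _ _); apply: val_inj.
  (* The Schur complement of the pivot. *)
  pose T1 := T - a^-1 *: (v *m u).
  have MF : M = block_mx 1%:M 0 (a^-1 *: v) 1%:M *m (block_mx a%:M 0 0 T1)
      *m block_mx 1%:M (a^-1 *: u) 0 1%:M.
    rewrite ME !mulmx_block !(mul1mx, mul0mx, mulmx0, mulmx1, addr0, add0r).
    congr block_mx.
    - by rewrite mul_scalar_mx scalerA divff ?scale1r.
    - by rewrite mul_mx_scalar scalerA divff ?scale1r.
    - rewrite mul_mx_scalar scalerA divff// scale1r -scalemxAr /T1.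
      by rewrite addrC subrK.
  have detM : \det M = a * \det T1.
    rewrite MF !det_mulmx det_lblock !det_ublock !det1 !mulr1 !mul1r.
    by rewrite det_mx11 mxE eqxx mulr1n.
  have uT1 : T1 \in unitmx.
    rewrite unitmxE unitfE; move: uM; rewrite unitmxE unitfE detM.
    by rewrite mulf_eq0 negb_or => /andP[].
  have gd : gpres (mulmx_tuple (block_mx a%:M 0 0 T1 : 'M[R]_(1 + p))) (`|\det T1| * `|a|).
    apply: (@gpres_fiber p _ (fun _ => mulmx_tuple T1) a 0) => //.
    - move=> x y; rewrite mulmx_tuple_block tadd0 big1// => j _.
      by rewrite mxE mul0r.
    - by move=> _; exact: IH.
  have gM := gpresM (gpresM (@gpres_lower p (a^-1 *: v)) gd) (@gpres_upper p (a^-1 *: u)).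
  by rewrite -MF mul1r mulr1 mulrC -normrM -detM in gM.
have [a0|a0] := eqVneq (S' 0 0) 0; last exact: main.
(* Otherwise the first column would be zero, against invertibility. *)
have [i Si0] : exists i, S' (rshift 1 i) 0 != 0.
  apply: contrapT => /forallNP Si.
  have : col 0 S' = 0.
    apply/matrixP => i j; rewrite !mxE.
    case: (unliftP ord0 i) => [k ->|->]; last exact: a0.
    by have /negP := Si k; rewrite negbK => /eqP <-; congr (S' _ _); apply: val_inj.
  rewrite colE => /(congr1 (mulmx (invmx S'))); rewrite mulKmx// mulmx0.
  by move=> /matrixP /(_ 0 0) /eqP; rewrite !mxE !eqxx oner_eq0.
pose u : 'rV[R]_p := delta_mx 0 i.
pose E c : 'M[R]_(1 + p) := block_mx 1%:M (c *: u) 0 1%:M.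
have detE c : \det (E c) = 1 by rewrite det_ublock !det1 mulr1.
have EE : E (-1) *m E 1 = 1%:M.
  rewrite mulmx_block !(mul1mx, mul0mx, mulmx0, mulmx1, addr0, add0r).
  by rewrite -scalerDl subrr scale0r -scalar_mx_block.
have uM : E 1 *m S' \in unitmx.
  by rewrite unitmx_mul [X in _ && X]uS andbT unitmxE detE unitr1.
have M00 : (E 1 *m S') 0 0 != 0.
  have Z : (0 : 'I_(1 + p)) = lshift p 0 by apply: val_inj.
  rewrite Z in Si0 a0 *.
  rewrite mxE big_split_ord /= big_ord1 block_mxEul a0 mulr0 add0r.
  rewrite (bigD1 i)//= big1 => [|j ji].
    by rewrite block_mxEur scale1r mxE !eqxx mul1r addr0.
  by rewrite block_mxEur scale1r mxE eqxx /= (negbTE ji) mul0r.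
have gS := gpresM (@gpres_upper p (-1 *: u)) (main _ uM M00).
by rewrite -/(E (-1)) mulmxA EE mul1mx mul1r det_mulmx detE mul1r in gS.
Qed.
End gaussian_change.

(** * Likelihood ratios with bounded second moment (one plus the chi-square divergence) *)

Definition dens d (T : measurableType d) (R : realType) (P Q : probability T R)
    (C : R) :=
  exists L : T -> R, [/\ measurable_fun setT L, forall x, 0 <= L x,
    forall f : T -> \bar R, measurable_fun setT f -> (forall x, 0 <= f x)%E ->
      (\int[P]_x f x = \int[Q]_x (f x * (L x)%:E))%E &
    (\int[Q]_x (L x ^+ 2)%:E <= C%:E)%E].

Section dens_theory.
Context d (T : measurableType d) (R : realType).

Lemma measurable_thead n : measurable_fun setT (fun z : n.+1.-tuple T => thead z).
Proof. exact: measurable_tnth. Qed.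

Lemma thead_tcons n x (y : n.-tuple T) : thead (tcons (x, y)) = x.
Proof. by []. Qed.

Lemma behead_tcons n x (y : n.-tuple T) : [tuple of behead (tcons (x, y))] = y.
Proof. exact: val_inj. Qed.

(** The likelihood ratio of a sample is the product of the individual ones, and by Tonelli its
    second moment is the product of theirs. *)
Lemma dens_iid (P Q : probability T R) (C : R) n : 0 <= C -> dens P Q C ->
  dens (iid P n) (iid Q n) (C ^+ n).
Proof.
move=> C0 [L [mL L0 PL LC]]; elim: n => [|n [M [mM M0 PM MC]]].
  exists (cst 1); split => //.
  - by move=> f mf f0; rewrite /=; apply: eq_integral => x _; rewrite mule1.
  - by rewrite integral_iid0//= expr1n expr0.
have mEL : measurable_fun setT (fun x => (L x)%:E) by exact/measurable_EFinP.
have mEM : measurable_fun setT (fun x => (M x)%:E) by exact/measurable_EFinP.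
pose N (z : n.+1.-tuple T) := L (thead z) * M [tuple of behead z].
have NE x y : N (tcons (x, y)) = L x * M y by rewrite /N thead_tcons behead_tcons.
have mN : measurable_fun setT N.
  apply: measurable_funM.
  - exact: (@measurableT_comp _ _ _ _ _ _ L setT _ mL (@measurable_thead n)).
  - exact: (@measurableT_comp _ _ _ _ _ _ M setT _ mM (@measurable_behead _ T n)).
have mEN : measurable_fun setT (fun x => (N x)%:E) by exact/measurable_EFinP.
have mx (x : T) : measurable_fun setT (fun y : n.-tuple T => tcons (x, y)).
  by apply: (@measurable_cons _ _ _ _ (cst x) _ id).
exists N; split => //.
- by move=> x; rewrite mulr_ge0.
- move=> f mf f0.
  have mfx (x : T) : measurable_fun setT (fun y : n.-tuple T => f (tcons (x, y))).
    exact: (@measurableT_comp _ _ _ _ _ _ f setT _ mf (mx x)).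
  rewrite !ge0_integral_iidS//; last 2 first.
  - exact: emeasurable_funM.
  - by move=> z; rewrite mule_ge0// lee_fin mulr_ge0.
  rewrite PL; last 2 first.
  - have := @measurable_fun_fubini_tonelli_F _ _ T (n.-tuple T) R (iid P n)
      (fun xy => f (tcons xy)).
    apply => [|x]; last exact: f0.
    exact: (@measurableT_comp _ _ _ _ _ _ f setT (@tcons _ T n) mf (@measurable_tcons _ T n)).
  - by move=> x; apply: integral_ge0.
  apply: eq_integral => x _; rewrite PM//.
  rewrite -ge0_integralZr//.
  - by apply: eq_integral => y _; rewrite NE EFinM muleA muleAC.
  - exact: emeasurable_funM.
  - by move=> y _; rewrite mule_ge0// lee_fin.
  - by rewrite lee_fin.
- rewrite ge0_integral_iidS; last 2 first.
  + by apply/measurable_EFinP; apply: measurable_funX.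
  + by move=> z; rewrite lee_fin sqr_ge0.
  have mM2 : measurable_fun setT (fun x => (M x ^+ 2)%:E).
    by apply/measurable_EFinP; apply: measurable_funX.
  have mL2 : measurable_fun setT (fun x => (L x ^+ 2)%:E).
    by apply/measurable_EFinP; apply: measurable_funX.
  have I0 : (0 <= \int[iid Q n]_y (M y ^+ 2)%:E)%E.
    by apply: integral_ge0 => y _; rewrite lee_fin sqr_ge0.
  rewrite (_ : (\int[Q]_x _)%E = ((\int[Q]_x (L x ^+ 2)%:E) * (\int[iid Q n]_y (M y ^+ 2)%:E))%E).
    rewrite exprS EFinM; apply: lee_pmul => //.
    by apply: integral_ge0 => x _; rewrite lee_fin sqr_ge0.
  rewrite -ge0_integralZr//; last by move=> x _; rewrite lee_fin sqr_ge0.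
  apply: eq_integral => x _; rewrite -ge0_integralZl//.
  + by apply: eq_integral => y _; rewrite NE exprMn EFinM.
  + by move=> y _; rewrite lee_fin sqr_ge0.
  + by rewrite lee_fin sqr_ge0.
Qed.

(* AM-GM in the form [L <= t / 2 + L ^ 2 / (2 t)], integrated over [A]. *)
Lemma dens_le (P Q : probability T R) (C t : R) (A : set T) :
  0 < t -> dens P Q C -> measurable A ->
  (P A <= (t / 2)%:E * Q A + (C / (2 * t))%:E)%E.
Proof.
move=> t0 [L [mL L0 PL LC]] mA.
have t2 : 0 < 2 * t by rewrite mulr_gt0.
have mI : measurable_fun setT (fun x => (\1_A x)%:E : \bar R).
  by apply/measurable_EFinP; exact: measurable_indic.
have I0 x : (0 <= (\1_A x)%:E :> \bar R)%E by rewrite lee_fin.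
have PE (P' : probability T R) : P' A = (\int[P']_x (\1_A x)%:E)%E.
  by rewrite integral_indic// setIT.
rewrite (PE P) PL//.
have mL2 : measurable_fun setT (fun x => (L x ^+ 2)%:E).
  by apply/measurable_EFinP; apply: measurable_funX.
have mtI : measurable_fun setT (fun x => (t / 2)%:E * (\1_A x)%:E : \bar R)%E.
  exact: emeasurable_funM.
have mtL : measurable_fun setT (fun x => ((2 * t)^-1)%:E * (L x ^+ 2)%:E : \bar R)%E.
  exact: emeasurable_funM.
have c0 : 0 <= t / 2 by rewrite divr_ge0// ltW.
have c1 : 0 <= (2 * t)^-1 by rewrite invr_ge0 ltW.
apply: (@le_trans _ _ (\int[Q]_x ((t / 2)%:E * (\1_A x)%:E + ((2 * t)^-1)%:E * (L x ^+ 2)%:E))%E).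
  apply: ge0_le_integral => //.
  - by move=> x _; rewrite mule_ge0// lee_fin.
  - by apply: emeasurable_funM => //; exact/measurable_EFinP.
  - exact: emeasurable_funD.
  - move=> x _; rewrite -!EFinM -EFinD lee_fin indicE; case: (x \in A) => /=.
      rewrite mul1r mulr1 -subr_ge0.
      rewrite (_ : _ - _ = (2 * t)^-1 * (t - L x) ^+ 2).
        by rewrite mulr_ge0// sqr_ge0.
      by field; rewrite gt_eqF.
    by rewrite mul0r mulr0 add0r mulr_ge0// sqr_ge0.
rewrite ge0_integralD//.
- rewrite !ge0_integralZl//.
  + rewrite -PE leeD2l// [C / _]mulrC EFinM; apply: lee_wpmul2l; last exact: LC.
    by rewrite lee_fin.
  + by move=> x _; rewrite lee_fin sqr_ge0.
- by move=> x _; rewrite mule_ge0// lee_fin.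
- by move=> x _; rewrite mule_ge0// lee_fin// sqr_ge0.
Qed.

End dens_theory.

Section gaussian_dens.
Context {R : realType}.

Lemma tsq_mulmx p (W : 'M[R]_p) (z : p.-tuple R) :
  tsq (mulmx_tuple W z) = \sum_j \sum_k (W^T *m W) j k * (tnth z j * tnth z k).
Proof.
rewrite /tsq; under eq_bigr do rewrite tnth_mktuple expr2 mulr_suml.
rewrite exchange_big; apply: eq_bigr => j _ /=.
under eq_bigr do rewrite mulr_sumr; rewrite exchange_big; apply: eq_bigr => k _ /=.
by rewrite mxE mulr_suml; apply: eq_bigr => i _; rewrite mxE; ring.
Qed.

Lemma tsq_id p (z : p.-tuple R) :
  tsq z = \sum_j \sum_k (1%:M : 'M[R]_p) j k * (tnth z j * tnth z k).
Proof. by rewrite -{1}(mulmx_tuple1 z) tsq_mulmx trmx1 mul1mx. Qed.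

(** The density is L(z) = |det V| exp((|z|^2 - |V z|^2) / 2). Since |W z|^2 = 2 |V z|^2 - |z|^2, L^2
    times the standard Gaussian density is proportional to exp(- |W z|^2 / 2), and the second moment
    is (det V)^2 / |det W|. *)
Lemma gaussian_dens p (S W : 'M[R]_p) (V := invmx S) (C : R) :
  S \in unitmx -> W \in unitmx -> W^T *m W = 2 *: (V^T *m V) - 1%:M ->
  (\det V) ^+ 2 <= C * `|\det W| ->
  dens (distribution (iid std_normal p) (mulmx_tuple S)) (iid std_normal p) C.
Proof.
move=> uS uW WV VC.
have dW : 0 < `|\det W| by rewrite normr_gt0 -unitfE -unitmxE.
have dS : 0 < `|\det S| by rewrite normr_gt0 -unitfE -unitmxE.
have tsqW z : tsq (mulmx_tuple W z) = 2 * tsq (mulmx_tuple V z) - tsq z.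
  rewrite [tsq z]tsq_id !tsq_mulmx WV mulr_sumr -sumrB; apply: eq_bigr => j _.
  rewrite mulr_sumr -sumrB; apply: eq_bigr => k _.
  by rewrite !mxE; ring.
have mexp (U : 'M[R]_p) (a b : R) : measurable_fun setT
    (fun z => expR (a * tsq z + b * tsq (mulmx_tuple U z))).
  apply: measurableT_comp => //; apply: measurable_funD; apply: measurable_funM => //.
    exact: measurable_tsq.
  exact: (@measurableT_comp _ _ _ _ _ _ _ setT _ (@measurable_tsq _ p) (measurable_mulmx_tuple U)).
pose h (z : p.-tuple R) := expR (2^-1 * tsq z + (- 2^-1) * tsq (mulmx_tuple V z)).
exists (fun z => `|\det V| * h z); split.
- by apply: measurable_funM => //; exact: mexp.
- by move=> z; rewrite mulr_ge0// expR_ge0.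
- move=> f mf f0; rewrite ge0_integral_distribution//.
  (* Chosen so that g(S z) times [gw z] is f(S z); the zero term fits the shape of [mexp]. *)
  pose g z := (f z * (expR (0 * tsq z + (- 2^-1) * tsq (mulmx_tuple V z)))%:E)%E.
  have mg : measurable_fun setT g by apply: emeasurable_funM => //; exact/measurable_EFinP.
  have g0 z : (0 <= g z)%E by rewrite mule_ge0// lee_fin expR_ge0.
  have := gpres_unitmx uS mg g0.
  rewrite (_ : (\int[_]_z (g (mulmx_tuple S z) * gw z))%E =
      (\int[iid std_normal p]_z (f \o mulmx_tuple S) z)%E); last first.
    apply: eq_integral => z _; rewrite /g /gw -mulmx_tupleM mulVmx// mulmx_tuple1.
    rewrite -muleA -EFinM -expRD mul0r add0r.
    by rewrite (_ : _ + _ = 0) ?expR0 ?mule1//; field.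
  move=> E.
  transitivity (`|\det V|%:E * \int[iid std_normal p]_z (g z * gw z))%E.
    rewrite -E muleA -EFinM -normrM -det_mulmx mulVmx// det1 normr1 mul1e//.
  rewrite -[LHS]ge0_integralZl//.
  + apply: eq_integral => z _; rewrite /g /gw mul0r add0r -(muleA (f z)) -EFinM -expRD.
    rewrite /h EFinM [RHS]muleCA; do 2 congr (_ * _)%E.
    by congr (expR _)%:E; rewrite addrC (mulrC (tsq z)).
  + by apply: emeasurable_funM => //; exact: measurable_gw.
  + by move=> z _; rewrite mule_ge0// gw_ge0.
(* [k] is the inverse of [gw], so the right side of the change of variables by [W] is the total mass
   1. *)
- pose k (z : p.-tuple R) := (expR ((- 2^-1) * tsq z + 0 * tsq (mulmx_tuple V z)))%:E.
  have mk : measurable_fun setT k by exact/measurable_EFinP.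
  have k0 z : (0 <= k z)%E by rewrite lee_fin expR_ge0.
  have mkW : measurable_fun setT (fun z => k (mulmx_tuple W z)).
    exact: (@measurableT_comp _ _ _ _ _ _ k setT _ mk (measurable_mulmx_tuple W)).
  have := gpres_unitmx uW mk k0.
  rewrite [in RHS](_ : (\int[_]_z _)%E = 1%E); last first.
    rewrite -(@probability_setT _ _ _ (iid std_normal p)) -[RHS]mul1e -integral_cst//.
    apply: eq_integral => z _; rewrite /k /gw -EFinM -expRD mul0r addr0.
    by rewrite (_ : _ + _ = 0) ?expR0//; field.
  move=> E.
  rewrite (_ : (\int[_]_x _)%E =
      ((\det V ^+ 2)%:E * \int[iid std_normal p]_z (k (mulmx_tuple W z) * gw z))%E).
    rewrite -(@lee_pmul2l _ `|\det W|%:E)// ?lte_fin//.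
    by rewrite muleCA E mule1 -EFinM lee_fin mulrC.
  rewrite -[RHS]ge0_integralZl//.
  + apply: eq_integral => z _; rewrite /k /gw tsqW /h exprMn real_normK ?num_real//.
    rewrite -!EFinM; congr EFin; congr (_ * _).
    rewrite -expRM_natl -expRD; congr expR; rewrite mul0r addr0; by field.
  + by apply: emeasurable_funM => //; exact: measurable_gw.
  + by move=> z _; rewrite mule_ge0// gw_ge0.
  + by rewrite lee_fin sqr_ge0.
Qed.
End gaussian_dens.

(** * The testing argument *)

Section monotone.
Context d (T : measurableType d) (R : realType).

(** The integral is a supremum over simple functions below the integrand, so monotonicity holds for
    arbitrary nonnegative functions, such as the squared losses here. *)
Lemma ge0_le_integral_nonmeasurable (mu : {measure set T -> \bar R}) (f g : T -> \bar R) :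
  (forall x, 0 <= f x)%E -> (forall x, f x <= g x)%E ->
  (\int[mu]_x f x <= \int[mu]_x g x)%E.
Proof.
move=> f0 fg; have g0 x : (0 <= g x)%E by exact: le_trans (f0 x) (fg x).
rewrite !ge0_integralE//; apply: le_ereal_sup => _ [h hf <-].
exists h => // x; apply: (le_trans (hf x)).
by rewrite /patch; case: ifP.
Qed.

(** The sets are arbitrary, because error events are not known to be measurable. At any set, [iid]
    is a Dirac value or an integral of its values at sections. *)
Lemma iid_le (P : probability T R) n (A B : set (n.-tuple T)) :
  A `<=` B -> (iid P n A <= iid P n B)%E.
Proof.
elim: n A B => [|n IH] A B AB.
  rewrite /= /dirac lee_fin !indicE ler_nat.
  case: (boolP ([tuple] \in A)) => // /set_mem/AB/mem_set.
  by case: (_ \in B).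
apply: ge0_le_integral_nonmeasurable => x /=; first exact: measure_ge0.
apply: IH => y; rewrite /xsection /= !inE => H; exact: AB.
Qed.

End monotone.

Section measurable_res.
Context d (T : measurableType d) (R : realType).

Lemma measurable_det n (f : T -> 'M[R]_n) :
  (forall i j, measurable_fun setT (fun x => f x i j)) ->
  measurable_fun setT (fun x => \det (f x)).
Proof.
move=> mf; apply: measurable_sum => s; apply: measurable_funM => //.
by apply: measurable_prod => i _; exact: mf.
Qed.

Lemma det_spec n (Q : 'M[R]_n) (l : 'rV[R]_n) : Q *m Q^T = 1%:M ->
  \det (Q^T *m diag_mx l *m Q) = \prod_i l 0 i.
Proof.
move=> QQ; rewrite !det_mulmx mulrAC -det_mulmx orthC// det1 mul1r det_diag.
by [].
Qed.

Lemma posdef_det n (A : 'M[R]_n) : posdef A -> 0 < \det A.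
Proof.
move=> pA; have [Q [l [QQ AE]]] := spectral_sym (proj1 pA).
rewrite AE det_spec//; apply: prodr_gt0 => i _.
by apply: (posdef_spec QQ); rewrite -AE.
Qed.

Lemma posdef_1D n (A : 'M[R]_n) : posdef A -> posdef (1%:M + A).
Proof.
move=> [AT Ap]; split; first by rewrite linearD /= trmx1 AT.
move=> v v0; rewrite mulmxDr mulmx1 mulmxDl mxDE -fsq_cV.
by rewrite ltr_wpDl ?fsq_ge0//; exact: Ap.
Qed.

Lemma measurable_res n (f : T -> 'M[R]_n) : estimator f ->
  forall i j, measurable_fun setT (fun x => res (f x) i j).
Proof.
move=> [mf pf] i j.
have m1 i' j' : measurable_fun setT (fun x => (1%:M + f x) i' j').
  by under eq_fun do rewrite mxDE; exact: measurable_funD.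
(* Cramer's rule; the positive determinant is inverted through [ln] and [expR], whose measurability
   is at hand. *)
have E x : res (f x) i j = expR (- ln (\det (1%:M + f x))) * cofactor (1%:M + f x) j i.
  have pD := posdef_1D (pf x).
  rewrite /res /invmx (posdef_unit pD) mxZE mxE; congr (_ * _).
  by rewrite expRN lnK// posrE; exact: posdef_det.
under eq_fun do rewrite E.
apply: measurable_funM.
  apply: measurableT_comp => //; apply: measurableT_comp => //.
  by apply: measurableT_comp => //; exact: measurable_det.
apply: measurable_funM => //; apply: measurable_det => i' j'.
by under eq_fun do rewrite !mxE; exact: measurable_funD.
Qed.

Lemma measurable_fsq_lt m n (f : T -> 'M[R]_(m, n)) (M : 'M[R]_(m, n)) s :
  (forall i j, measurable_fun setT (fun x => f x i j)) ->
  measurable [set x | fsq (f x - M) < s].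
Proof.
move=> mf.
have mg : measurable_fun setT (fun x => fsq (f x - M)).
  apply: measurable_sum => i; apply: measurable_sum => j; apply: measurable_funX.
  by under eq_fun do rewrite mxDE; exact: measurable_funD.
have := mg measurableT `]-oo, s[%classic (measurable_itv _).
by rewrite setTI; congr measurable; apply/seteqP; split => x /=; rewrite in_itv.
Qed.

End measurable_res.

(** * Second moment of the Gaussian likelihood ratio *)

Section law.
Context {R : realType}.

(** With W^T W = 2 Theta - 1, which is positive definite because Theta >= 3/4, [gaussian_dens]
    leaves one inequality for each eigenvalue x: x <= exp((x - 1)^2) sqrt(2 x - 1). *)
Lemma sample_law_dens p n (Theta : 'M[R]_p) : posdef Theta ->
  (forall v : 'cV[R]_p, 3 / 4 * fsq v <= (v^T *m Theta *m v) 0 0) ->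
  dens (sample_law n Theta) (iid (iid std_normal p) n)
    (expR (fsq (Theta - 1%:M)) ^+ n).
Proof.
move=> pT qT; apply: dens_iid; first exact: expR_ge0.
have [ST SS uS] := sqrtmxP (posdef_inv pT).
have [Q [l [QQ TE]]] := spectral_sym (proj1 pT).
have l34 i : 3 / 4 <= l 0 i.
  have [u1 <-] := spec_quad l i QQ; rewrite -TE.
  by apply: le_trans (qT _); rewrite u1 mulr1.
have VV : (invmx (sqrtmx (invmx Theta)))^T *m invmx (sqrtmx (invmx Theta)) = Theta.
  rewrite trmx_inv ST; move: SS uS; set S := sqrtmx _ => SS uS.
  rewrite -[LHS]mul1mx -(mulmxV (posdef_unit pT)) -SS -!mulmxA (mulmxA S (invmx S)).
  by rewrite mulmxV// mul1mx mulmxV// mulmx1.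
pose W := diag_mx (\row_i Num.sqrt (2 * l 0 i - 1)) *m Q.
have l1 i : 0 < 2 * l 0 i - 1 by have := l34 i; lra.
have WW : W^T *m W = 2 *: Theta - 1%:M.
  rewrite /W trmx_mul tr_diag_mx -mulmxA (mulmxA (diag_mx _)) mulmx_diag mulmxA.
  rewrite (_ : diag_mx _ = 2 *: diag_mx l - 1%:M).
    rewrite mulmxBr mulmxBl mulmx1 orthC//; congr (_ - _).
    by rewrite -scalemxAr -scalemxAl -TE.
  apply/matrixP => i j; rewrite !mxE -expr2 sqr_sqrtr; last exact: ltW.
  by case: (i == j); rewrite ?mulr1n ?mulr0n ?mulr0 ?subr0.
have detQ : `|\det Q| = 1.
  have := congr1 (fun M => \det M) QQ; rewrite det_mulmx det_tr det1 -expr2 => Q2.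
  by apply/eqP; rewrite -(@eqrXn2 _ 2)// ?expr1n ?real_normK ?num_real// Q2.
have detW : `|\det W| = \prod_i Num.sqrt (2 * l 0 i - 1).
  rewrite det_mulmx normrM detQ mulr1 det_diag ger0_norm.
    by apply: eq_bigr => i _; rewrite mxE.
  by apply: prodr_ge0 => i _; rewrite mxE sqrtr_ge0.
have uW : W \in unitmx.
  rewrite unitmxE unitfE -normr_gt0 detW; apply: prodr_gt0 => i _.
  by rewrite sqrtr_gt0.
have detV : \det (invmx (sqrtmx (invmx Theta))) ^+ 2 = \prod_i l 0 i.
  by rewrite expr2 -{1}det_tr -det_mulmx VV TE det_spec.
apply: (gaussian_dens uS uW); first by rewrite VV.
rewrite detV detW (_ : fsq _ = \sum_i (l 0 i - 1) ^+ 2); last first.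
  rewrite {1}TE (_ : _ - _ = Q^T *m diag_mx (\row_i (l 0 i - 1)) *m Q).
    by rewrite fsq_spec//; apply: eq_bigr => i _; rewrite mxE.
  rewrite (_ : diag_mx (\row_i _) = diag_mx l - 1%:M).
    by rewrite mulmxBr mulmxBl mulmx1 orthC.
  by apply/matrixP => i j; rewrite !mxE; case: (i == j); rewrite ?mulr1n ?mulr0n ?subr0.
rewrite expR_sum -big_split /=; apply: ler_prod => i _.
have li := l34 i; have l0 : 0 <= l 0 i by lra.
rewrite l0 /=; set x := l 0 i in li l0 *.
rewrite -(@ler_pXn2r _ 2)// ?nnegrE ?mulr_ge0 ?expR_ge0 ?sqrtr_ge0//.
rewrite exprMn sqr_sqrtr; last by lra.
have e1 := expR_ge1Dx ((x - 1) ^+ 2).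
set y := (x - 1) ^+ 2 in e1 *; have y0 : 0 <= y by rewrite sqr_ge0.
have e2 : 1 + 2 * y <= expR y ^+ 2 by nra.
(* (1 + 2 y) (2 x - 1) - x^2 = y (4 x - 3); this is where x >= 3/4 is used. *)
apply: (@le_trans _ _ ((1 + 2 * y) * (2 * x - 1))).
  have : 0 <= y * (4 * x - 3) by rewrite mulr_ge0//; lra.
  by rewrite /y; lra.
by rewrite ler_wpM2r//; lra.
Qed.

End law.

Section core.
Context dX (X : measurableType dX) (R : realType).

(* A Bayesian form of Fano's inequality with chi-square in place of mutual information:
   every ball of radius [sqrt s] contains at most a fraction [1 / (16 C)] of the good
   parameters, and [P A <= 2 C Q A + 1 / 8]. *)
Lemma exists_error_half (T : finType) e (P : T -> probability X R) (Q : probability X R)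
    (C : R) (bad : pred T) (M : T -> 'M[R]_e) (s : R) (r : X -> 'M[R]_e) :
  (forall i j, measurable_fun setT (fun x => r x i j)) ->
  0 < C -> (forall tau, dens (P tau) Q C) ->
  (0 < #|T|)%N -> (#|bad| * 4 <= #|T|)%N ->
  (forall sigma, ~~ bad sigma ->
    16 * C * #|[pred tau | ~~ bad tau && (fsq (M tau - M sigma) < 4 * s)]|%:R <= #|T|%:R) ->
  exists tau, ((2^-1)%:E <= P tau [set x | (s <= fsq (r x - M tau))%R])%E.
Proof.
move=> mr C0 dP T0 cbad cball; apply: contrapT => /forallNP H.
pose A tau := [set x | fsq (r x - M tau) < s].
have mA tau : measurable (A tau) by exact: measurable_fsq_lt.
have PA tau : 2^-1 < fine (P tau (A tau)).
  have /negP := H tau; rewrite -ltNge.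
  rewrite (_ : [set x | _] = ~` A tau); last first.
    by apply/seteqP; split => x /=; rewrite leNgt => /negP.
  rewrite probability_setC// -[P tau (A tau)]fineK ?fin_num_measure//.
  by rewrite -EFinB lte_fin; lra.
have QA tau : 3 / (16 * C) < fine (Q (A tau)).
  have t0 : 0 < 4 * C by rewrite mulr_gt0.
  have := dens_le t0 (dP tau) (mA tau).
  rewrite -[P tau (A tau)]fineK ?fin_num_measure// -[Q (A tau)]fineK ?fin_num_measure//.
  rewrite -EFinM -EFinD lee_fin; have := PA tau.
  rewrite (_ : C / (2 * (4 * C)) = 8^-1); last by field; rewrite gt_eqF.
  move=> h1 h2; rewrite ltr_pdivrMr ?mulr_gt0//; lra.
(* At least three quarters of the parameters are good, so the sum is at least 9/4 of #|T| / (16 C),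
   while [upper] bounds it by that quantity. *)
have lower : 3 / 4 * #|T|%:R * (3 / (16 * C)) <= \sum_(tau | ~~ bad tau) fine (Q (A tau)).
  apply: (@le_trans _ _ (\sum_(tau | ~~ bad tau) 3 / (16 * C))); last first.
    by apply: ler_sum => tau _; exact: ltW.
  have c0 : 0 <= 3 / (16 * C) by rewrite ltW// divr_gt0// mulr_gt0.
  rewrite sumr_const -[leRHS]mulr_natl ler_wpM2r//.
  have := cardC bad; move/(congr1 (fun n => n%:R : R)); rewrite natrD.
  move: cbad; rewrite -(ler_nat R) natrM.
  rewrite (_ : #|[predC bad]| = #|[pred tau | ~~ bad tau]|)//.
  by set a := #|bad|%:R; set b := #|[pred _ | _]|%:R; set c := _%:R; lra.
have upper : \sum_(tau | ~~ bad tau) fine (Q (A tau)) <= #|T|%:R / (16 * C).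
  rewrite -lee_fin -sumEFin.
  under eq_bigr do rewrite fineK ?fin_num_measure//.
  have QE tau : Q (A tau) = (\int[Q]_x (\1_(A tau) x)%:E)%E by rewrite integral_indic// setIT.
  under eq_bigr do rewrite QE.
  rewrite -big_filter -ge0_integral_sum//; last first.
    by move=> tau; apply/measurable_EFinP; exact: measurable_indic.
  have -> : (#|T|%:R / (16 * C))%:E = (\int[Q]_x (#|T|%:R / (16 * C))%:E)%E.
    have Q1 : Q setT = 1%E by exact: probability_setT.
    by rewrite integral_cst// -[LHS]mule1; congr (_ * _)%E.
  apply: ge0_le_integral_nonmeasurable => x.
    by apply: sume_ge0 => tau _; rewrite lee_fin.
  rewrite big_filter sumEFin lee_fin.
  (* If r x is close to the good parameter [sigma], every other good parameter close to it is within
     twice the radius of [sigma], so [cball] bounds their number. *)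
  have [[sigma gs As]|noA] := pselect (exists2 sigma, ~~ bad sigma & A sigma x); last first.
    rewrite big1; first by rewrite ltW// divr_gt0 ?mulr_gt0 ?ltr0n.
    move=> tau gt.
    by rewrite indicE memNset// => At; apply: noA; exists tau.
  rewrite ler_pdivlMr ?mulr_gt0// mulrC; apply: le_trans (cball _ gs).
  have c0 : 0 <= 16 * C by rewrite ltW// mulr_gt0.
  rewrite ler_wpM2l// -sum1_card natr_sum big_mkcond [leRHS]big_mkcond /=.
  apply: ler_sum => tau _; rewrite inE; case: (boolP (bad tau)) => //= gt.
  rewrite indicE; case: (boolP (x \in A tau)) => [/set_mem At|_] /=; last by case: ifP.
  rewrite ifT//; have -> : M tau - M sigma = (r x - M sigma) + (- (r x - M tau)).
    by rewrite opprB [RHS]addrC addrA subrK.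
  apply: le_lt_trans (fsqD_le _ _) _; rewrite fsqN.
  by move: At As; rewrite /A /=; lra.
have := le_trans lower upper.
have T0' : 0 < #|T|%:R :> R by rewrite ltr0n.
have : 0 < #|T|%:R / (16 * C) by rewrite divr_gt0// mulr_gt0.
rewrite (_ : 3 / 4 * _ * _ = 9 / 4 * (#|T|%:R / (16 * C))); last by field; rewrite gt_eqF.
by lra.
Qed.

End core.

(** * A packing for the resolvent distance *)

Section packing.
Context {R : realType}.

Lemma exists_packing (m : nat) (e : R) : (2 <= m)%N -> 0 < e -> e <= 2 ^- 12 ->
  exists (T : finType) (Theta : T -> 'M[R]_m) (bad : pred T) (N : nat),
  [/\ (0 < N)%N, (0 < #|T|)%N, (#|bad| * 4 <= #|T|)%N,
    forall tau, [/\ posdef (Theta tau), \det (Theta tau) = 1,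
      forall v : 'cV[R]_m,
        3 / 4 * fsq v <= (v^T *m Theta tau *m v) 0 0 <= 2 * fsq v &
      m%:R * fsq (Theta tau - 1%:M) <= 6 * e ^+ 2 * N%:R] &
    forall sigma, ~~ bad sigma ->
    (#|[pred tau | ~~ bad tau &&
       (fsq (res (Theta tau) - res (Theta sigma)) < 4 * (e ^+ 2 * 2 ^- 18 * m%:R * 2 ^- 9))%R]|
      * 32 ^ N <= #|T|)%N].
Proof.
move=> m2 e0 e12.
(* Halving [m] makes both block sizes comparable with it; [m = 3] is the extreme case of p + q <= 3
   p. *)
have [p [q [mE p0 pq q2 qm]]] : exists p q : nat,
    [/\ m = (p + q)%N, (0 < p)%N, (p <= q)%N, (p + q <= 3 * p)%N & (p + q <= 2 * q)%N].
  exists m./2, (m - m./2)%N; have := odd_double_half m.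
  have : (odd m <= 1)%N by case: (odd m).
  rewrite -addnn; move: (nat_of_bool (odd m)) m2 => o.
  by move=> *; split; lia.
subst m; clear m2.
pose h : R := 2 ^- 10.
have h0 : 0 < h by rewrite invr_gt0 exprn_gt0.
have eh : 4 * e <= h.
  by rewrite /h; move: e12; lra.
pose bad := [pred tau : grid p q | 8 * p%:R < fsq ((@gmx R p q tau)^T *m gmx tau)].
exists (grid p q), (fun tau => theta h e (gmx tau)), bad, (p * q)%N; split.
- by rewrite muln_gt0 p0 (leq_trans p0).
- by rewrite card_grid expn_gt0.
- exact: card_bad.
- move=> tau; split.
  + exact: theta_posdef.
  + exact: theta_det.
  + by move=> v; exact: theta_quad.
  + have t1 := theta_sub1 h0 e0 eh (gmx tau).
    have g1 := @fsq_gmx R p q p0 pq tau.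
    have e2 : 0 <= 3 * e ^+ 2 by rewrite mulr_ge0// sqr_ge0.
    have t2 : fsq (theta h e (gmx tau) - 1%:M) <= 3 * e ^+ 2 * p%:R.
      by apply: (le_trans t1); rewrite ler_wpM2l.
    apply: (@le_trans _ _ ((2 * q%:R) * (3 * e ^+ 2 * p%:R))).
      apply: ler_pM => //; first exact: fsq_ge0.
      by rewrite -natrM ler_nat.
    by rewrite natrM le_eqVlt; apply/orP; left; apply/eqP; ring.
- move=> sigma; rewrite -leNgt => gs.
  have -> : #|{: grid p q}| = (4 ^ (p * q) * 32 ^ (p * q))%N by rewrite card_grid -expnMn.
  rewrite leq_mul2r; apply/orP; right.
  apply: leq_trans (@card_hamming_ball R p q sigma).
  apply: subset_leq_card; apply/fintype.subsetP => tau.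
  rewrite !inE -leNgt => /andP[gt].
  (* With h = 2^-10 and rho = 2^-18, 21 * 64^2 * (4 h^2 + rho) = 21/32. *)
  move=> lt4; apply: (@hamming_trunc R p q p0 pq h (2 ^- 18)) => //.
    by rewrite /h; lra.
  have q3 (t : grid p q) : forall v : 'cV[R]_(p + q),
      0 <= (v^T *m theta h e (gmx t) *m v) 0 0 <= 2 * fsq v.
    move=> v; have /andP[a b] := theta_quad h0 e0 eh (gmx t) v.
    by rewrite b andbT; apply: le_trans a; rewrite mulr_ge0// fsq_ge0.
  have := fsq_sub_le_res (theta_posdef h0 e0 eh (gmx tau)) (theta_posdef h0 e0 eh (gmx sigma))
    (q3 tau) (q3 sigma).
  have := theta_sub h e (gmx tau) (gmx sigma).
  set x := fsq (trunc _ _ - _); set y := fsq _; set z := fsq (res _ - _) in lt4 *.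
  move=> h1 h2.
  have mp : (p + q)%:R <= 3 * p%:R :> R by rewrite -natrM ler_nat.
  have e2 : 0 < e ^+ 2 by rewrite exprn_gt0.
  rewrite -(@ler_pM2l _ (2 * e ^+ 2)) ?mulr_gt0//.
  apply: (le_trans h1); apply: (le_trans h2).
  (* The constants fit because 81 * 4 * 3 = 972 is at most 2 * 2^9. *)
  have : e ^+ 2 * (p + q)%:R <= e ^+ 2 * (3 * p%:R) by rewrite ler_wpM2l// ltW.
  have : 0 <= e ^+ 2 * p%:R by rewrite mulr_ge0// ltW.
  by move: lt4; lra.
Qed.

End packing.

(** * From error events to minimax risks *)

Section minimax_bounds.
Context {R : realType} dX (X : measurableType dX) (p : nat).
Variables (S : set 'M[R]_p) (P : 'M[R]_p -> probability X R).
Variable dist : 'M[R]_p -> 'M[R]_p -> R.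

(* The event [G] is part of the statement because the error event itself is not
   known to be measurable. *)
Definition error_half (thr : R) (delta : X -> 'M[R]_p) :=
  exists Theta G, [/\ S Theta, measurable G,
    G `<=` [set x | thr <= dist (delta x) Theta] & ((2^-1)%:E <= P Theta G)%E].

Lemma error_half_sup thr delta :
  (forall Theta A B, A `<=` B -> (P Theta A <= P Theta B)%E) ->
  error_half thr delta ->
  ((2^-1)%:E <= sup_error_prob S P dist delta thr)%E.
Proof.
move=> Pm [Th [G [STh mG Gs PG]]]; apply: (le_trans PG).
apply: (le_trans (Pm Th _ _ Gs)); apply: ereal_sup_ubound.
by exists Th.
Qed.

(** Markov's inequality: the squared loss is at least [thr ^+ 2] on [G]. *)
Lemma error_half_risk thr : 0 <= thr ->
  (forall delta, estimator delta -> error_half thr delta) ->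
  ((2^-1 * thr ^+ 2)%:E <= minimax_sq_risk S P dist)%E.
Proof.
move=> thr0 H; apply: le_ereal_inf_tmp => _ [delta edelta <-].
have [Th [G [STh mG Gs PG]]] := H _ edelta.
apply: (@le_trans _ _ (expectation (P Th) (fun x => dist (delta x) Th ^+ 2))); last first.
  by apply: ereal_sup_ubound; exists Th.
have t2 : 0 <= thr ^+ 2 by rewrite sqr_ge0.
apply: (@le_trans _ _ (\int[P Th]_x ((thr ^+ 2)%:E * (\1_G x)%:E))%E).
  rewrite ge0_integralZl//; last by apply/measurable_EFinP; exact: measurable_indic.
  by rewrite integral_indic// setIT mulrC EFinM lee_wpmul2l.
rewrite unlock; apply: ge0_le_integral_nonmeasurable => x.
  by rewrite -EFinM lee_fin mulr_ge0.
rewrite -EFinM lee_fin indicE; case: (boolP (x \in G)) => [/set_mem/Gs /= h|_].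
  by rewrite mulr1 ler_pXn2r// nnegrE (le_trans thr0).
by rewrite mulr0 sqr_ge0.
Qed.

End minimax_bounds.

(** * Rates for one mode and for the full precision *)

Section mode_bounds.
Context {R : realType}.

Lemma dens_le_cst d (T : measurableType d) (P Q : probability T R) (C C' : R) :
  C <= C' -> dens P Q C -> dens P Q C'.
Proof.
move=> CC [L [mL L0 PL LC]]; exists L; split => //.
by apply: (le_trans LC); rewrite lee_fin.
Qed.

Lemma expR_half_le2 : expR (2^-1 : R) <= 2.
Proof.
have h := expR_ge1Dx (- 2^-1 : R).
have : expR (2^-1) * expR (- 2^-1) = 1 :> R by rewrite -expRD subrr expR0.
have := expR_gt0 (2^-1 : R).
by nra.
Qed.

Variables (k n : nat) (d : 'I_k -> nat) (a : 'I_k).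
Hypothesis n1 : (1 <= n)%N.
Hypothesis d2 : forall b, (2 <= d b)%N.

Let D : R := (\prod_b d b)%:R.
Let da : R := (d a)%:R.
Let K := @mode_precision R k d a.

(** Common factor of the three rates: as it stands for [d_op], times the root of [da] for [d_FR] in
    one mode, times the root of [D] for the full precision. *)
Definition rate : R := Num.min 1 (da / Num.sqrt (n%:R * D)).
Let sep : R := (2 ^- 12 * rate) ^+ 2 * 2 ^- 18 * da * 2 ^- 9.

Let D0 : 0 < D. Proof. by rewrite ltr0n prodn_gt0// => b; exact: ltnW. Qed.
Let da0 : 0 < da. Proof. by rewrite ltr0n ltnW. Qed.
Let nD0 : 0 < n%:R * D. Proof. by rewrite mulr_gt0// ltr0n. Qed.

Lemma rate_gt0 : 0 < rate.
Proof. by rewrite lt_min ltr01 /= divr_gt0// sqrtr_gt0. Qed.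

Lemma rate_sqr : rate ^+ 2 = Num.min 1 (da ^+ 2 / (n%:R * D)).
Proof.
have s0 : 0 < da / Num.sqrt (n%:R * D) by rewrite divr_gt0// sqrtr_gt0.
have E : da ^+ 2 / (n%:R * D) = (da / Num.sqrt (n%:R * D)) ^+ 2.
  by rewrite expr_div_n sqr_sqrtr// ltW.
rewrite E /rate; set x := _ / _ in s0 *.
have [x1|x1] := leP 1 x.
  by rewrite !min_l ?expr1n// exprn_ege1.
by rewrite !min_r ?(ltW x1)// exprn_ile1// ltW.
Qed.

(** [f] stands for the quantity estimated: the identity with c = 1 for one factor, or the embedding
    [K] with c = D / da for the full precision. *)
Lemma mode_error_half (e : nat) (f : 'M[R]_(d a) -> 'M[R]_e) (c : R)
    (delta : n.-tuple (#|mindex d|.-tuple R) -> 'M[R]_e) :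
  0 < c ->
  (forall A B : 'M[R]_(d a), posdef A -> posdef B ->
    fsq (res (f A) - res (f B)) = c * fsq (res A - res B)) ->
  estimator delta ->
  exists Theta : 'M[R]_(d a), [/\ posdef Theta, det1_ball 1 Theta &
    ((2^-1)%:E <= sample_law n (K Theta)
       [set x | (c * sep <= fsq (res (delta x) - res (f Theta)))%R])%E].
Proof.
move=> c0 fE edelta.
have r0 := rate_gt0.
have r1 : rate <= 1 by rewrite ge_min lexx.
have e0 : 0 < 2 ^- 12 * rate :> R by rewrite mulr_gt0// invr_gt0 exprn_gt0.
have e1 : 2 ^- 12 * rate <= 2 ^- 12 :> R.
  by rewrite ler_piMr// invr_ge0 exprn_ge0.
have [T [Th [bad [N [N0 T0 cbad pTh cball]]]]] := exists_packing (d2 a) e0 e1.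
have pD : #|mindex d|%:R = D by rewrite card_mindex.
(* The embedding multiplies |Theta - 1|^2 by D / da, and the choice of [rate] keeps the exponent for
   [n] observations below N / 2; then exp(1/2) <= 2. *)
have dT tau : dens (sample_law n (K (Th tau))) (iid (iid std_normal #|mindex d|) n) (2 ^+ N : R).
  have [pT dT qT fT] := pTh tau.
  have pK := mode_posdef pT.
  apply: dens_le_cst (sample_law_dens n pK _); last first.
    by apply: mode_ge; [exact: (proj1 pT)|move=> v; have /andP[] := qT v].
  have : fsq (K (Th tau) - 1%:M) = D / da * fsq (Th tau - 1%:M).
    have := fsq_mode (Th tau - 1%:M); rewrite pD modeB mode1 -/da => E.
    by rewrite mulrAC -E mulrAC mulfV ?gt_eqF// mul1r.
  move=> ->; rewrite -expRM_natl.
  apply: (@le_trans _ _ (expR (N%:R * 2^-1))); last first.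
    by rewrite expRM_natl; apply: lerXn2r; rewrite ?nnegrE ?expR_ge0// expR_half_le2.
  rewrite ler_expR.
  have rs : (n%:R * D) * rate ^+ 2 <= da ^+ 2.
    rewrite -ler_pdivlMl// mulrC rate_sqr ge_min lexx orbT//.
  have := fT; rewrite -/da => fT'.
  have : n%:R * (D / da * fsq (Th tau - 1%:M)) <=
      (n%:R * D) / da ^+ 2 * (6 * (2 ^- 12 * rate) ^+ 2 * N%:R).
    rewrite (_ : n%:R * _ = n%:R * D / da ^+ 2 * (da * fsq (Th tau - 1%:M))).
      by rewrite ler_wpM2l// divr_ge0 ?sqr_ge0// ltW.
    by field; rewrite gt_eqF.
  move=> h; apply: (le_trans h).
  rewrite (_ : _ * (_ * N%:R) = 
      (n%:R * D * rate ^+ 2 / da ^+ 2) * (6 * (2 ^- 12) ^+ 2 * N%:R)); last first.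
    by field; rewrite gt_eqF.
  have x1 : n%:R * D * rate ^+ 2 / da ^+ 2 <= 1 by rewrite ler_pdivrMr ?mul1r ?exprn_gt0.
  have N0' : 0 <= N%:R :> R by [].
  apply: (@le_trans _ _ (1 * (6 * (2 ^- 12) ^+ 2 * N%:R))).
    by rewrite ler_wpM2r// mulr_ge0// mulr_ge0// sqr_ge0.
  by rewrite mul1r; lra.
have [|sigma gs|tau Ptau] := @exists_error_half _ _ R T e
    (fun tau => sample_law n (K (Th tau))) (iid (iid std_normal #|mindex d|) n) (2 ^+ N) bad
    (fun tau => res (f (Th tau))) (c * sep) (fun x => res (delta x))
    (measurable_res edelta) _ dT T0 cbad.
- by rewrite exprn_gt0.
- have := cball sigma gs; rewrite -(ler_nat R) natrM natrX => h.
  set B := [pred tau | _]; set B' := [pred tau | _] in h.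
  have -> : #|B| = #|B'|.
    apply: eq_card => tau; rewrite !inE; congr (_ && _).
    have [pT _ _ _] := pTh tau; have [pS _ _ _] := pTh sigma.
    by rewrite fE// mulrCA ltr_pM2l.
  apply: le_trans h; rewrite [leRHS]mulrC ler_wpM2r//.
  (* 16 * 2^N <= 32^N because N >= 1. *)
  have -> : 32 = 16 * 2 :> R by ring.
  rewrite exprMn ler_wpM2r ?exprn_ge0// -[leLHS]expr1 ler_eXn2l//.
  by rewrite ltr1n.
have [pT dtT qT _] := pTh tau.
exists (Th tau); split => //; split => //.
apply: d_op1_le1 => // v; have /andP[h1 h2] := qT v; rewrite h2 andbT.
by apply: le_trans h1; rewrite ler_wpM2r ?fsq_ge0//; lra.
Qed.

End mode_bounds.

Section mode_rates.
Context {R : realType} (k n : nat) (d : 'I_k -> nat) (a : 'I_k).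
Hypothesis n1 : (1 <= n)%N.
Hypothesis d2 : forall b, (2 <= d b)%N.

Let D : R := (\prod_b d b)%:R.
Let da : R := (d a)%:R.
Let X : measurableType _ := n.-tuple (#|mindex d|.-tuple R).
Let rt : R := rate n d a.
Let law_mode (Th : 'M[R]_(d a)) : probability X R :=
  sample_law n (mode_precision Th).

Let D0 : 0 < D. Proof. by rewrite ltr0n prodn_gt0// => b; exact: ltnW. Qed.
Let da0 : 0 < da. Proof. by rewrite ltr0n ltnW. Qed.
Let rt0 : 0 < rt. Proof. exact: rate_gt0. Qed.

Lemma measurable_error e (delta : X -> 'M[R]_e) (M : 'M[R]_e) (s : R) :
  estimator delta -> measurable [set x | s <= fsq (res (delta x) - M)].
Proof.
move=> edelta; rewrite (_ : [set _ | _] = ~` [set x | fsq (res (delta x) - M) < s]).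
  by apply: measurableC; apply: measurable_fsq_lt; exact: measurable_res.
by apply/seteqP; split => x /=; rewrite leNgt => /negP.
Qed.

Lemma error_half_FR (delta : X -> 'M[R]_(d a)) : estimator delta ->
  error_half (det1_ball 1) law_mode d_FR (2 ^- 25 * (Num.sqrt da * rt)) delta.
Proof.
move=> edelta.
have [//|Th [pT bT PT]] := @mode_error_half R k n d a n1 d2 _ id 1 delta ltr01 _ edelta.
  by move=> A B _ _; rewrite mul1r.
exists Th, [set x | 1 * ((2 ^- 12 * rt) ^+ 2 * 2 ^- 18 * da * 2 ^- 9) <=
  fsq (res (delta x) - res Th)].
split => //; first exact: measurable_error.
(* The constants agree exactly: 2 * 2^-24 * 2^-18 * 2^-9 = (2^-25)^2. *)
move=> x /= h; have := res_le_d_FR (proj2 edelta x) pT.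
have t0 : 0 <= 2 ^- 25 * (Num.sqrt da * rt) :> R.
  by rewrite !mulr_ge0 ?invr_ge0 ?exprn_ge0 ?sqrtr_ge0// ltW.
have E : (2 ^- 25 * (Num.sqrt da * rt)) ^+ 2 = (2 ^- 25) ^+ 2 * (da * rt ^+ 2).
  by rewrite !exprMn sqr_sqrtr// ltW.
have f0 : 0 <= d_FR (delta x) Th by rewrite mulr_ge0 ?invr_ge0 ?sqrtr_ge0.
move=> h2; rewrite -(@ler_pXn2r _ 2)// E.
move: h h2; set z := fsq _; set y := d_FR _ _ ^+ 2; move: rt da => u v.
lra.
Qed.

(** The same parameter and event serve, since 2 d_FR^2 <= da d_op^2. *)
Lemma error_half_op (delta : X -> 'M[R]_(d a)) : estimator delta ->
  error_half (det1_ball 1) law_mode d_op (2 ^- 25 * rt) delta.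
Proof.
move=> edelta; have [Th [G [bT mG Gs PG]]] := error_half_FR edelta.
exists Th, G; split => // x /Gs /= h.
have o0 : 0 <= d_op (delta x) Th by exact: opnorm_ge0.
have t0 : 0 <= 2 ^- 25 * rt :> R by rewrite mulr_ge0 ?invr_ge0 ?exprn_ge0// ltW.
rewrite -(@ler_pXn2r _ 2)// -(ler_pM2l da0).
have := d_FR_le_d_op (delta x) Th; rewrite -/da.
have : (2 ^- 25 * (Num.sqrt da * rt)) ^+ 2 <= d_FR (delta x) Th ^+ 2.
  rewrite ler_pXn2r// nnegrE; last by rewrite mulr_ge0 ?invr_ge0 ?sqrtr_ge0.
  by rewrite !mulr_ge0 ?invr_ge0 ?exprn_ge0 ?sqrtr_ge0// ltW.
have -> : (2 ^- 25 * (Num.sqrt da * rt)) ^+ 2 = da * (2 ^- 25 * rt) ^+ 2.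
  by rewrite !exprMn sqr_sqrtr ?ltW// mulrCA.
set y := d_FR _ _ ^+ 2; set z := d_op _ _ ^+ 2; have y0 : 0 <= y by rewrite sqr_ge0.
move=> h1 h2; by apply: le_trans h1 _; apply: le_trans h2; lra.
Qed.

Lemma error_half_full (delta : X -> 'M[R]_#|mindex d|) : estimator delta ->
  error_half (kron_class R k d) (sample_law n) d_FR (2 ^- 25 * (Num.sqrt D * rt)) delta.
Proof.
move=> edelta; have c0 : 0 < D / da by rewrite divr_gt0.
have fE (A B : 'M[R]_(d a)) : posdef A -> posdef B ->
    fsq (res (mode_precision A) - res (mode_precision B)) = D / da * fsq (res A - res B).
  move=> pA pB; rewrite -!mode_res// -modeB.
  have cD : #|mindex d|%:R = D by rewrite card_mindex.
  have := fsq_mode (res A - res B); rewrite cD -/da => E.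
  by rewrite mulrAC -E mulrAC mulfV ?gt_eqF// mul1r.
have [Th [pT bT PT]] :=
  @mode_error_half R k n d a n1 d2 _ (@mode_precision R k d a) _ delta c0 fE edelta.
have pK := mode_posdef pT.
exists (mode_precision Th), [set x | D / da * ((2 ^- 12 * rt) ^+ 2 * 2 ^- 18 * da * 2 ^- 9) <=
  fsq (res (delta x) - res (mode_precision Th))].
split => //; [exact: mode_in_class|exact: measurable_error|].
move=> x /= h; have := res_le_d_FR (proj2 edelta x) pK.
have t0 : 0 <= 2 ^- 25 * (Num.sqrt D * rt) :> R.
  by rewrite !mulr_ge0 ?invr_ge0 ?exprn_ge0 ?sqrtr_ge0// ltW.
have E : (2 ^- 25 * (Num.sqrt D * rt)) ^+ 2 = (2 ^- 25) ^+ 2 * (D * rt ^+ 2).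
  by rewrite !exprMn sqr_sqrtr// ltW.
have f0 : 0 <= d_FR (delta x) (mode_precision Th) by rewrite mulr_ge0 ?invr_ge0 ?sqrtr_ge0.
move=> h2; rewrite -(@ler_pXn2r _ 2)// E.
move: h h2; rewrite (_ : D / da * _ = (2 ^- 12 * rt) ^+ 2 * 2 ^- 18 * D * 2 ^- 9); last first.
  by field; rewrite gt_eqF.
set z := fsq _; set y := d_FR _ _ ^+ 2; move: rt D => u v.
lra.
Qed.

End mode_rates.

Theorem proposition1 (R : realType) :
  exists c r c1 c2 c3 : R,
    [/\ 0 < c, 0 < r, 0 < c1, 0 < c2 & 0 < c3] /\
    forall (k n : nat) (d : 'I_k -> nat),
      (1 <= k)%N -> (1 <= n)%N -> (forall a, (2 <= d a)%N) ->
      let D : R := (\prod_a d a)%:R in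
      let dmax : R := (\max_a d a)%:R in
      let X : measurableType _ := n.-tuple (#|mindex d|.-tuple R) in
      let law : 'M[R]_#|mindex d| -> probability X R :=
        sample_law n in
      let law_mode a (Theta_a : 'M[R]_(d a)) : probability X R :=
        law (mode_precision Theta_a) in
      [/\ forall a : 'I_k,
            let da : R := (d a)%:R in
            forall delta : X -> 'M[R]_(d a), estimator delta ->
              ((2^-1)%:E <= sup_error_prob (det1_ball r) (law_mode a) d_FR delta
                 (c * Num.min (Num.sqrt da)
                              (da `^ (3 / 2) / Num.sqrt (n%:R * D)))%R)%E /\
              ((2^-1)%:E <= sup_error_prob (det1_ball r) (law_mode a) d_op delta
                 (c * Num.min 1 (da / Num.sqrt (n%:R * D)))%R)%E,
          forall delta : X -> 'M[R]_#|mindex d|, estimator delta ->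
            ((2^-1)%:E <= sup_error_prob (kron_class R k d) law d_FR delta
               (c * Num.min (Num.sqrt D) (dmax / Num.sqrt n%:R))%R)%E,
          forall a : 'I_k,
            let da : R := (d a)%:R in
            ((c1 * Num.min da (da ^+ 3 / (n%:R * D)))%:E
               <= minimax_sq_risk (det1_ball r) (law_mode a) d_FR)%E /\
            ((c2 * Num.min 1 (da ^+ 2 / (n%:R * D)))%:E
               <= minimax_sq_risk (det1_ball r) (law_mode a) d_op)%E
        & ((c3 * Num.min D (dmax ^+ 2 / n%:R))%:E
             <= minimax_sq_risk (kron_class R k d) law d_FR)%E ].
Proof.
pose c : R := 2 ^- 25.
have c0 : 0 < c by rewrite invr_gt0 exprn_gt0.
have c10 : 0 < 2^-1 * c ^+ 2 by rewrite mulr_gt0// exprn_gt0.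
exists c, 1, (2^-1 * c ^+ 2), (2^-1 * c ^+ 2), (2^-1 * c ^+ 2); split; first by split.
move=> k n d k1 n1 d2 D dmax X law law_mode.
have mono (Th : 'M[R]_#|mindex d|) (A B : set X) : A `<=` B -> (law Th A <= law Th B)%E.
  exact: iid_le.
have n0 : 0 < n%:R :> R by rewrite ltr0n.
have D0 : 0 < D by rewrite ltr0n prodn_gt0// => b; exact: ltnW.
have nD0 : 0 < n%:R * D by rewrite mulr_gt0.
pose rt a : R := rate n d a.
have rt0 a : 0 < rt a by exact: rate_gt0.
have da0 a : 0 < (d a)%:R :> R by rewrite ltr0n ltnW.
have rateFR a : Num.min (Num.sqrt (d a)%:R) ((d a)%:R `^ (3 / 2) / Num.sqrt (n%:R * D))
    = Num.sqrt (d a)%:R * rt a.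
  rewrite /rt /rate -/D minr_pMr ?sqrtr_ge0// mulr1; congr Num.min.
  rewrite (_ : 3 / 2 = 2^-1 + 1); last by lra.
  by rewrite powRD ?gt_eqF ?implybT// powRr1 ?ltW// powR12_sqrt ?ltW// mulrA.
(* The largest mode, used for the full precision: there sqrt D times dmax / sqrt(n D) is dmax / sqrt
   n. *)
have [a0 a0E] : {a0 | (\max_a d a)%N = d a0}.
  by apply: bigop.eq_bigmax; rewrite card_ord.
have ratefull : Num.min (Num.sqrt D) (dmax / Num.sqrt n%:R) = Num.sqrt D * rt a0.
  rewrite /rt /rate -/D /dmax a0E minr_pMr ?sqrtr_ge0// mulr1; congr Num.min.
  rewrite sqrtrM ?ltW//; field.
  by rewrite !gt_eqF// sqrtr_gt0.
have riskFR a : 2^-1 * (c * (Num.sqrt (d a)%:R * rt a)) ^+ 2 =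
    2^-1 * c ^+ 2 * Num.min (d a)%:R ((d a)%:R ^+ 3 / (n%:R * D)).
  rewrite !exprMn sqr_sqrtr ?ltW// rate_sqr// minr_pMr ?ltW// mulr1.
  by rewrite mulrA; congr (_ * Num.min _ _); rewrite -/D exprS -!mulrA.
have riskfull : 2^-1 * (c * (Num.sqrt D * rt a0)) ^+ 2 =
    2^-1 * c ^+ 2 * Num.min D (dmax ^+ 2 / n%:R).
  rewrite !exprMn sqr_sqrtr ?ltW// rate_sqr// minr_pMr ?ltW// mulr1 -/D /dmax a0E mulrA.
  congr (_ * Num.min _ _); field.
  by rewrite !gt_eqF.
split.
- move=> a da delta edelta; split.
    rewrite rateFR; apply: error_half_sup => [Th A B|]; first exact: mono.
    exact: error_half_FR.
  apply: error_half_sup => [Th A B|]; first exact: mono.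
  exact: error_half_op.
- move=> delta edelta; rewrite ratefull.
  by apply: error_half_sup => //; exact: error_half_full.
- move=> a da; split.
    rewrite -riskFR; apply: error_half_risk => [|delta]; last exact: error_half_FR.
    by rewrite !mulr_ge0 ?sqrtr_ge0// ltW.
  rewrite -rate_sqr// -mulrA -exprMn; apply: error_half_risk => [|delta]; last exact: error_half_op.
  by rewrite mulr_ge0// ltW.
- rewrite -riskfull; apply: error_half_risk => [|delta]; last exact: error_half_full.
  by rewrite !mulr_ge0 ?sqrtr_ge0// ltW.
Qed.
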